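(* Let $W$ be a representation of a semigroup $\Sigma$ that splits as a direct sum of pairwise non-isomorphic indecomposable subrepresentations. Let $\lambda_0<\lambda_1$. Then, in the space of continuously differentiable curves $L:(\lambda_0,\lambda_1)\to\mathrm{End}(W)$ with the $C^1$-topology, the set of curves in general position is open and dense.
   Context: A representation of a semigroup $\Sigma$ in a finite-dimensional real vector space $W$ is a map $\sigma\mapsto A_\sigma\in\mathfrak{gl}(W)$ with $A_\sigma A_\tau=A_{\sigma\tau}$; subrepresentations are invariant subspaces; $W\neq0$ is indecomposable if it is not a direct sum of two nonzero subrepresentations; $\mathrm{End}(U)$ is the algebra of linear maps commuting with the action and $\mathrm{End}^{\mathrm{Nil}}(U)$ its nilpotent elements. An indecomposable $U$ is absolutely indecomposable (of real type) if $\mathrm{End}(U)/\mathrm{End}^{\mathrm{Nil}}(U)\cong\mathbb{R}$ (i.e. has dimension $1$). For $L\in\mathrm{End}(W)$, $L^S$ is its semisimple part and $\ker L^S$ its generalized kernel (a subrepresentation). A curve $\lambda\mapsto L(\lambda)$ is in general position if for each $\lambda\in(\lambda_0,\lambda_1)$ either $L(\lambda)$ is invertible or $\ker L(\lambda)^S$ is absolutely indecomposable. *)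

(* Defs.v *)
From HB Require Import structures.
From Stdlib Require Import Reals ClassicalEpsilon FunctionalExtensionality.
From mathcomp Require Import all_boot all_order all_algebra.

Set Implicit Arguments.
Unset Strict Implicit.
Unset Printing Implicit Defensive.

Definition Reqb (x y : R) : bool := if Req_EM_T x y then true else false.

Lemma Reqb_axiom : Equality.axiom Reqb.
Proof. by move=> x y; rewrite /Reqb; case: Req_EM_T => h; constructor. Qed.

HB.instance Definition _ := hasDecEq.Build R Reqb_axiom.

Definition Rfind (P : pred R) (n : nat) : option R :=
  match excluded_middle_informative (exists x, P x) with
  | left h => Some (proj1_sig (constructive_indefinite_description _ h))
  | right _ => None
  end.

Lemma Rfind_correct P n x : Rfind P n = Some x -> P x.
Proof.
rewrite /Rfind; case: excluded_middle_informative => // h [<-].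
exact: (proj2_sig (constructive_indefinite_description _ h)).
Qed.

Lemma Rfind_complete (P : pred R) : (exists x, P x) -> exists n, Rfind P n.
Proof. by move=> h; exists 0%N; rewrite /Rfind; case: excluded_middle_informative. Qed.

Lemma Rfind_ext (P Q : pred R) : P =1 Q -> Rfind P =1 Rfind Q.
Proof. by move=> h; rewrite (functional_extensionality P Q h). Qed.

HB.instance Definition _ := hasChoice.Build R Rfind_correct Rfind_complete Rfind_ext.

Lemma R_addA : associative Rplus.
Proof. by move=> x y z; rewrite Rplus_assoc. Qed.
Lemma R_mulA : associative Rmult.
Proof. by move=> x y z; rewrite Rmult_assoc. Qed.

Lemma R_addNr : left_inverse R0 Ropp Rplus.
Proof. by move=> x; rewrite Rplus_comm Rplus_opp_r. Qed.
Lemma R_add0r : left_id R0 Rplus.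
Proof. exact: Rplus_0_l. Qed.

HB.instance Definition _ :=
  @GRing.isZmodule.Build R R0 Ropp Rplus R_addA Rplus_comm R_add0r R_addNr.

Lemma R_mul1r : left_id R1 Rmult.
Proof. exact: Rmult_1_l. Qed.
Lemma R_mulrDl : left_distributive Rmult Rplus.
Proof. by move=> x y z; rewrite Rmult_plus_distr_r. Qed.
Lemma R_one_neq0 : (R1 : R) != R0.
Proof. by apply/eqP; exact: R1_neq_R0. Qed.

HB.instance Definition _ :=
  @GRing.Zmodule_isComNzRing.Build R R1 Rmult R_mulA Rmult_comm R_mul1r R_mulrDl R_one_neq0.

Definition Rinvx (x : R) : R := if Req_EM_T x R0 then R0 else Rinv x.

Lemma R_mulVf (x : R) : x != R0 -> (Rinvx x * x)%R = R1.
Proof.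
move/eqP=> h; rewrite /Rinvx.
destruct (Req_EM_T x R0) as [e|ne]; first by [].
exact: Rinv_l.
Qed.

Lemma R_inv0 : Rinvx R0 = R0.
Proof. by rewrite /Rinvx; case: Req_EM_T. Qed.

HB.instance Definition _ := @GRing.ComNzRing_isField.Build R Rinvx R_mulVf R_inv0.

(* Convention (MathComp row vectors): a matrix M : 'M_n acts on W = 'rV_n   *)
(* by v |-> v *m M.  Hence the operator composition A_s A_t (apply A_t,     *)
(* then A_s) is the matrix product  rho t *m rho s.  Subspaces of W are     *)
(* row spaces of matrices (mxalgebra).                                      *)

Local Open Scope ring_scope.

Definition is_representation (S : Type) (mul : S -> S -> S) (n : nat)
    (rho : S -> 'M[R]_n) : Prop :=
  forall s t, rho (mul s t) = rho t *m rho s.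

Definition is_endo (S : Type) (k : nat) (a : S -> 'M[R]_k) (g : 'M[R]_k) : Prop :=
  forall s, a s *m g = g *m a s.

Definition is_subrep (S : Type) (k : nat) (a : S -> 'M[R]_k) (U : 'M[R]_k) : Prop :=
  forall s, stablemx U (a s).

Definition indecomposable (S : Type) (k : nat) (a : S -> 'M[R]_k) : Prop :=
  (0 < k)%N /\
  forall U V : 'M[R]_k, is_subrep a U -> is_subrep a V ->
    \rank (U :&: V)%MS = 0%N -> \rank (U + V)%MS = k ->
    \rank U = 0%N \/ \rank V = 0%N.

Definition nilpotent_mx (k : nat) (g : 'M[R]_k) : Prop :=
  exists m : nat, g ^+ m = 0.

(* Absolutely indecomposable (of real type): indecomposable, and the       *)
(* quotient End(U)/End^Nil(U) has dimension 1.  Here E is the subspace of  *)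
(* 'M_k (encoded via mxvec) equal to End(U), N the one equal to End^Nil(U) *)
(* (which must be a linear subspace of End(U) for the quotient to make     *)
(* sense), and dim(E/N) = dim E - dim N = 1.                               *)
Definition abs_indecomposable (S : Type) (k : nat) (a : S -> 'M[R]_k) : Prop :=
  indecomposable a /\
  exists E N : 'M[R]_(k * k),
    (forall g : 'M[R]_k, (mxvec g <= E)%MS <-> is_endo a g) /\
    (forall g : 'M[R]_k, (mxvec g <= N)%MS <-> (is_endo a g /\ nilpotent_mx g)) /\
    \rank E = (\rank N).+1.

Definition isomorphic (S : Type) (k m : nat) (a : S -> 'M[R]_k) (b : S -> 'M[R]_m)
    : Prop :=
  exists T : 'M[R]_(k, m), [/\ row_free T, row_full T & forall s, a s *m T = T *m b s].

(* The subrepresentation on (the row space of) an invariant U : 'M_n,    *)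
(* written in the basis row_base U of U.                                 *)
Definition restrict (S : Type) (n : nat) (rho : S -> 'M[R]_n) (U : 'M[R]_n)
    : S -> 'M[R]_(\rank U) :=
  fun s => row_base U *m rho s *m pinvmx (row_base U).

Definition splits_nonisomorphic_indecomposables (S : Type) (n : nat)
    (rho : S -> 'M[R]_n) : Prop :=
  exists (m : nat) (Us : 'I_m -> 'M[R]_n),
    [/\ forall i, is_subrep rho (Us i),
        mxdirect (\sum_i Us i)%MS,
        \rank (\sum_i Us i)%MS = n,
        forall i, indecomposable (restrict rho (Us i)) &
        forall i j, i != j -> ~ isomorphic (restrict rho (Us i)) (restrict rho (Us j))].

Definition gen_kernel (n : nat) (L : 'M[R]_n) : 'M[R]_n := kermx (L ^+ n).

Local Close Scope ring_scope.

Definition in_interval (l0 l1 x : R) : Prop := Rlt l0 x /\ Rlt x l1.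

Definition C1_curve (n : nat) (l0 l1 : R) (L L' : R -> 'M[R]_n) : Prop :=
  forall x, in_interval l0 l1 x -> forall i j : 'I_n,
    derivable_pt_lim (fun t => L t i j) x (L' x i j) /\
    continuity_pt (fun t => L' t i j) x.

Definition C1_End_curve (S : Type) (n : nat) (rho : S -> 'M[R]_n) (l0 l1 : R)
    (L L' : R -> 'M[R]_n) : Prop :=
  C1_curve l0 l1 L L' /\ forall x, in_interval l0 l1 x -> is_endo rho (L x).

Definition general_position (S : Type) (n : nat) (rho : S -> 'M[R]_n) (l0 l1 : R)
    (L : R -> 'M[R]_n) : Prop :=
  forall x, in_interval l0 l1 x ->
    L x \in unitmx \/ abs_indecomposable (restrict rho (gen_kernel (L x))).

Definition pos_cont_fun (l0 l1 : R) (eps : R -> R) : Prop :=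
  forall x, in_interval l0 l1 x -> Rlt R0 (eps x) /\ continuity_pt eps x.

(* M is in the basic Whitney C^1 neighbourhood of size eps around L. *)
Definition C1_close (n : nat) (l0 l1 : R) (eps : R -> R)
    (L L' M M' : R -> 'M[R]_n) : Prop :=
  forall x, in_interval l0 l1 x -> forall i j : 'I_n,
    Rlt (Rabs (Rminus (M x i j) (L x i j))) (eps x) /\
    Rlt (Rabs (Rminus (M' x i j) (L' x i j))) (eps x).

(* Main.v *)
Require Import Defs.
From HB Require Import structures.
From Stdlib Require Import Reals Lra Lia ClassicalEpsilon Classical Wf_nat FunctionalExtensionality.
From mathcomp Require Import all_boot all_order all_algebra.
From Coquelicot Require Hierarchy Derive RInt RInt_analysis.

(** Split [W] into indecomposable summands [W_i], with projections [p_i].  As the [W_i] are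
    pairwise non-isomorphic, a composite [W_i -> W_j -> W_i] with [i <> j] is never invertible,
    so that "the diagonal block [X_ii] is invertible" is a multiplicative condition on the
    endomorphism [X].  Applied to the Fitting idempotent of [X] it shows that the generalized
    kernel of [X] is isomorphic to the sum of the [W_i] with [X_ii] nilpotent.  Hence [X] is
    invertible or has an absolutely indecomposable generalized kernel unless two diagonal
    blocks are nilpotent, or one of non-real type is: the forbidden set is a finite union of
    subspaces of codimension at least 2 of [End(W)].  It is closed, whence openness; for
    density one perturbs [L] to [L + psi (s P1 + t P2)], where [psi] is a small positive
    function, and the forbidden values of [(s, t)] lie on finitely many C^1 curves of the
    plane, which cannot fill the unit square. *)

Set Implicit Arguments.
Unset Strict Implicit.
Unset Printing Implicit Defensive.

Import GRing.Theory.

(** * Fitting idempotents *)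

(** Nilpotency of a diagonal block is a linear condition because the corner of a primitive
    idempotent is local: modulo its non-units it is a real division algebra, of dimension 1 for real
    type and at least 2 otherwise. Two nilpotent blocks, or one of non-real type, thus impose two
    independent linear equations, and no determinant has to be studied. Summands, kernels and
    isomorphisms are all turned into identities between idempotents of the endomorphism ring, where
    they can be compared without choosing bases. The interval is open, so neighbourhoods have a size
    that varies along it. For openness this size comes from the supremum of the radii of good balls,
    which is 1-Lipschitz in the endomorphism. For density, one pair [(s, t)] must serve all
    parameters at once; a C^1 curve on an open interval is a countable union of Lipschitz arcs, and
    each arc misses a smaller square inside any given square. *)

Section FittingIdempotents.
Local Open Scope ring_scope.

(** Write the characteristic polynomial as ['X^m * q] with [q] prime to ['X]. A Bezout relation
    between [q] and ['X^(n+1)], evaluated at [g], gives the projection [f = (u * q)(g)];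
    Cayley-Hamilton kills [f * g ^+ n.+1] because [m <= n.+1]. Polynomials in [g] commute with
    whatever commutes with [g]. *)
Lemma horner_mx_idem_bezout (F : fieldType) (n : nat) (g : 'M[F]_n.+1) :
  exists f v : 'M[F]_n.+1, [/\ f * f = f, f * g ^+ n.+1 = 0, v * g ^+ n.+1 = 1 - f
    & forall c, c * g = g * c -> c * f = f * c /\ c * v = v * c].
Proof.
have [m [q rq eq]] := multiplicity_XsubC (char_poly g) 0.
have cp0 : char_poly g != 0 by rewrite monic_neq0 // char_poly_monic.
rewrite cp0 /= in rq; rewrite subr0 in eq.
have mn : (m <= n.+1)%N.
  have := size_char_poly g; rewrite eq size_Mmonic ?monicXn //; last first.
    by apply: contraNneq rq => ->; rewrite root0.
  rewrite size_polyXn => E.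
  have: (0 < size q)%N by rewrite size_poly_gt0; apply: contraNneq rq => ->; rewrite root0.
  by move: E; case: (size q) => // k; rewrite addnS /= addSn => -[<-] _; rewrite leq_addl.
have cop : coprimep q ('X ^+ n.+1).
  by rewrite coprimep_expr // -['X]subr0 coprimep_XsubC.
have [[u v] /= /eqpP [[c1 c2] /= /andP [c10 c20] euv]] := Bezout_coprimepP _ _ cop.
(* Bezout gives 1 only up to the nonzero scalars [c1] and [c2], which the factor [c2^-1 * c1]
   corrects. *)
set f := horner_mx g ((c2^-1 * c1 : F) *: (u * q)).
exists f, (horner_mx g ((c2^-1 * c1 : F) *: v)).
have hX : horner_mx g ('X ^+ n.+1) = g ^+ n.+1 by rewrite rmorphXn /= horner_mx_X.
have fg : f * g ^+ n.+1 = 0.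
  have e2 : 'X ^+ n.+1 = 'X^m * 'X^(n.+1 - m) :> {poly F} by rewrite -exprD subnKC.
  rewrite -hX -rmorphM /= -!scalerAl -mulrA e2 [q * _]mulrA -eq.
  by rewrite !linearZ /= !rmorphM /= Cayley_Hamilton mul0r mulr0 !scaler0.
have vg : horner_mx g ((c2^-1 * c1 : F) *: v) * g ^+ n.+1 = 1 - f.
  rewrite -hX -rmorphM -[1](rmorph1 (horner_mx g)) -rmorphB /=; congr horner_mx.
  rewrite -!scalerAl; apply/eqP; rewrite eq_sym subr_eq addrC -scalerDr.
  by rewrite -scalerA euv scalerA mulVf // scale1r.
split => //.
- have: f * (1 - f) = 0.
    rewrite -vg; have -> : f * (horner_mx g ((c2^-1 * c1 : F) *: v) * g ^+ n.+1) =
       horner_mx g ((c2^-1 * c1 : F) *: v) * (f * g ^+ n.+1).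
      rewrite !mulrA; congr (_ * _); exact: comm_horner_mx2.
    by rewrite fg mulr0.
  by rewrite mulrBr mulr1 => /eqP; rewrite subr_eq0 => /eqP <-.
- by move=> c cg; split; apply: comm_mx_horner.
Qed.

(** [f] projects onto the generalized kernel and [h] inverts [g] on the complement. The last clause,
    applied to the [rho s], will make both of them endomorphisms of the representation. *)
Lemma fitting_idem (F : fieldType) (n : nat) (g : 'M[F]_n) :
  exists f h : 'M[F]_n, [/\ f * f = f, g ^+ n * f = 0, g * h = 1 - f, (f :=: kermx (g ^+ n))%MS
    & forall c, c * g = g * c -> c * f = f * c /\ c * h = h * c].
Proof.
case: n g => [|n] g.
  exists 0, 0; split; rewrite ?mulr0 ?mul0r //; first by rewrite [1 - 0]flatmx0.
    by apply/eqmxP; rewrite [kermx _]flatmx0 submx_refl.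
  by move=> c _; rewrite mulr0 mul0r.
have [f [v [ff fg vg comm]]] := horner_mx_idem_bezout g.
have cg : f * g ^+ n.+1 = g ^+ n.+1 * f.
  have /comm [] // : g ^+ n.+1 * g = g * g ^+ n.+1 by rewrite -exprSr exprS.
have [gf gv] := comm g erefl.
exists f, (v * g ^+ n); split => //.
- by rewrite -cg.
- by rewrite mulrA gv -mulrA -exprS.
- apply/eqmxP/andP; split; first by apply/sub_kermxP.
  have K0 : kermx (g ^+ n.+1) *m g ^+ n.+1 = 0 by apply: mulmx_ker.
  have gvn : g ^+ n.+1 * v = 1 - f.
    have /comm [_ h] : g ^+ n.+1 * g = g * g ^+ n.+1 by rewrite -exprSr exprS.
    by rewrite h vg.
  have E : kermx (g ^+ n.+1) *m (1 - f) = 0 by rewrite -gvn -mulmxE mulmxA K0 mul0mx.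
  move: E; rewrite mulmxBr mulmx1 => /eqP; rewrite subr_eq0 => /eqP ->; exact: submxMl.
- move=> c /[dup] cg' /comm [cf cv]; split => //.
  by rewrite mulrA cv -!mulrA; congr (_ * _); apply: commrX.
Qed.

End FittingIdempotents.

(** * Idempotents of the endomorphism algebra *)

Section EndomorphismRing.
Local Open Scope ring_scope.
Variables (S : Type) (n : nat) (rho : S -> 'M[R]_n).
Implicit Types e f g h u v x y : 'M[R]_n.

Lemma endo0 : is_endo rho 0. Proof. by move=> s; rewrite mulmx0 mul0mx. Qed.
Lemma endo1 : is_endo rho 1. Proof. by move=> s; rewrite mulmx1 mul1mx. Qed.
Lemma endoM x y : is_endo rho x -> is_endo rho y -> is_endo rho (x * y).
Proof. by move=> hx hy s; rewrite mulmxA hx -mulmxA hy mulmxA. Qed.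
Lemma endoD x y : is_endo rho x -> is_endo rho y -> is_endo rho (x + y).
Proof. by move=> hx hy s; rewrite mulmxDl mulmxDr hx hy. Qed.
Lemma endoZ (c : R) x : is_endo rho x -> is_endo rho (c *: x).
Proof. by move=> hx s; rewrite -scalemxAl -scalemxAr hx. Qed.
Lemma endoN x : is_endo rho x -> is_endo rho (- x).
Proof. by move=> hx s; rewrite mulmxN mulNmx hx. Qed.
Lemma endoB x y : is_endo rho x -> is_endo rho y -> is_endo rho (x - y).
Proof. by move=> hx hy; apply/endoD => //; apply/endoN. Qed.
Lemma endo_sum (I : Type) (r : seq I) (P : pred I) (F : I -> 'M[R]_n) :
  (forall i, P i -> is_endo rho (F i)) -> is_endo rho (\sum_(i <- r | P i) F i).
Proof. by move=> h; elim/big_ind: _ => //; [apply: endo0 | apply: endoD]. Qed.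

Lemma fitting g : is_endo rho g -> exists f h, [/\ is_endo rho f /\ is_endo rho h, f * f = f,
  g ^+ n * f = 0, g * h = 1 - f & (f :=: kermx (g ^+ n))%MS /\
  forall c, c * g = g * c -> c * f = f * c /\ c * h = h * c].
Proof.
move=> hg; have [f [h [ff gf gh fk comm]]] := fitting_idem g.
by exists f, h; split => //; split => s; have [] := comm (rho s) (hg s).
Qed.

(* The corner [e A e] of [A = End(W)], that is the endomorphisms of the summand [im e].
   For primitive [e] it is local: its non-units are nilpotent and form an ideal. *)
Definition corner e g := [/\ is_endo rho g, e * g = g & g * e = g].
Definition corner_unit e g := exists2 h, corner e h & g * h = e /\ h * g = e.
Definition prim_idem e := [/\ is_endo rho e, e * e = e, e <> 0 &
  forall f, corner e f -> f * f = f -> f = 0 \/ f = e].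
(* Murray-von Neumann equivalence: the summands [im e] and [im f] are isomorphic. *)
Definition equiv_idem e f :=
  exists u v, [/\ is_endo rho u, is_endo rho v, u * v = e & v * u = f].
(** Modulo non-units the corner consists of the multiples of [e]: its residue division algebra is
    the real line, expressed without forming the quotient. *)
Definition real_type e := forall g, corner e g -> exists c : R, ~ corner_unit e (g - c *: e).

Lemma corner_id e : is_endo rho e -> e * e = e -> corner e e.
Proof. by []. Qed.
Lemma corner0 e : corner e 0.
Proof. by split; rewrite ?mulr0 ?mul0r //; apply: endo0. Qed.
Lemma cornerM e x y : corner e x -> corner e y -> corner e (x * y).
Proof.
by move=> [a b c] [a' b' c']; split; [exact: endoM | rewrite mulrA b | rewrite -mulrA c'].
Qed.
Lemma cornerD e x y : corner e x -> corner e y -> corner e (x + y).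
Proof.
move=> [a b c] [a' b' c']; split; [exact: endoD | by rewrite mulrDr b b' | by rewrite mulrDl c c'].
Qed.
Lemma cornerZ e (c : R) x : corner e x -> corner e (c *: x).
Proof.
by move=> [a b b']; split; [exact: endoZ | rewrite -mulmxE -scalemxAr mulmxE b | rewrite -mulmxE -scalemxAl mulmxE b'].
Qed.
Lemma cornerN e x : corner e x -> corner e (- x).
Proof. by rewrite -scaleN1r => /cornerZ. Qed.
Lemma cornerB e x y : corner e x -> corner e y -> corner e (x - y).
Proof. by move=> hx hy; apply/cornerD => //; apply/cornerN. Qed.
Lemma corner_sandwich e x : is_endo rho e -> e * e = e -> is_endo rho x -> corner e (e * x * e).
Proof.
move=> he ee hx; split; first by do 2 apply: endoM => //.
  by rewrite !mulrA ee.
by rewrite -mulrA ee.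
Qed.
Lemma corner_trans e f g : corner e f -> corner f g -> corner e g.
Proof.
move=> [a b c] [a' b' c']; split => //; first by rewrite -b' mulrA b.
by rewrite -c' -mulrA c.
Qed.

Lemma corner_unitM e g h : corner_unit e g -> corner_unit e h -> corner_unit e (g * h).
Proof.
move=> [g' cg [gg g'g]] [h' ch [hh h'h]]; exists (h' * g'); first exact: cornerM.
have [[_ eg ge] [_ eh he]] := (cg, ch); split.
  by rewrite mulrA -(mulrA g) hh -mulrA eg.
by rewrite mulrA -(mulrA h') g'g he.
Qed.

(** With [k' = e * k * e], the product [k' * g] is an idempotent of the corner, hence 0 or [e], and
    it is not 0 because [g * (k' * g) * k' = e]. So one-sided inverses are two-sided, even those
    found outside the corner. *)
Lemma prim_inv_r e g k : prim_idem e -> corner e g -> is_endo rho k -> g * k = e ->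
  corner_unit e g.
Proof.
move=> [he ee e0 pe] cg hk gk; have [hg eg ge] := cg.
have ck := corner_sandwich he ee hk; exists (e * k * e) => //.
have gh : g * (e * k * e) = e by rewrite !mulrA ge gk.
split => //; case: (pe (e * k * e * g)) => //; first exact: cornerM.
  by rewrite mulrA -(mulrA _ g) gh -(mulrA _ e e) ee.
set k' := e * k * e in gh *; move=> hg0; case: e0.
have E : g * (k' * g) * k' = e by rewrite mulrA -[LHS]mulrA gh ee.
by rewrite -E hg0 mulr0 mul0r.
Qed.

Lemma prim_inv_l e g k : prim_idem e -> corner e g -> is_endo rho k -> k * g = e ->
  corner_unit e g.
Proof.
move=> [he ee e0 pe] cg hk gk; have [hg eg ge] := cg.
have ck := corner_sandwich he ee hk; exists (e * k * e) => //.
have gh : (e * k * e) * g = e by rewrite -!mulrA eg gk.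
split => //; case: (pe (g * (e * k * e))) => //; first exact: cornerM.
  by rewrite mulrA -(mulrA g _ g) gh ge.
set k' := e * k * e in gh *; move=> hg0; case: e0.
have E : k' * (g * k') * g = e by rewrite mulrA -[LHS]mulrA gh ee.
by rewrite -E hg0 mulr0 mul0r.
Qed.

Lemma prim_unitM e g h : prim_idem e -> corner e g -> corner e h ->
  corner_unit e (g * h) <-> corner_unit e g /\ corner_unit e h.
Proof.
move=> pe cg ch; split; last by case; apply: corner_unitM.
move=> [k [hk _ _] [ghk kgh]]; have [[hg _ _] [hh _ _]] := (cg, ch); split.
  by apply: (@prim_inv_r _ _ (h * k)); rewrite ?mulrA //; apply: endoM.
by apply: (@prim_inv_l _ _ (k * g)); rewrite -?mulrA //; apply: endoM.
Qed.

Lemma prim_nonunit0 e : prim_idem e -> ~ corner_unit e 0.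
Proof. by move=> [_ _ e0 _] [k _ []]; rewrite mul0r => /esym. Qed.

(** If [f] is the Fitting idempotent of [g], then [e * f] is an idempotent of the corner. If it is
    0, [g] is invertible on the image of [e]; if it is [e], [g ^+ n] vanishes there. *)
Lemma prim_nonunit_nilp e g : prim_idem e -> corner e g -> ~ corner_unit e g -> g ^+ n = 0.
Proof.
move=> pe [hg eg ge] nu; have [he ee e0 me] := pe.
have [f [h [[hf hh] ff gf gh [_ comm]]]] := fitting hg.
have [ef eh] := comm e (etrans eg (esym ge)).
case: (me (e * f)); first by split; [exact: endoM | rewrite mulrA ee | rewrite -mulrA -ef mulrA ee].
- by rewrite mulrA -(mulrA e f e) -ef mulrA ee -mulrA ff.
- move=> ef0; case: nu; apply: (@prim_inv_r _ _ (h * e)) => //; first exact: endoM.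
  by rewrite mulrA gh mulrBl mul1r -ef ef0 subr0.
- move=> efe; case: (posnP n) => [n0 | n0].
    by case: e0; move: (e); rewrite n0 => e'; rewrite [e']flatmx0.
  have En : g ^+ n = g ^+ n.-1 * g by rewrite -exprSr prednK.
  have -> : g ^+ n = g ^+ n * e by rewrite En -mulrA ge.
  by rewrite -efe ef mulrA gf mul0r.
Qed.

(** If [(g + h) * k = e], then [h * k = e - g * k] with [g * k] a non-unit, hence nilpotent; the
    geometric series inverts [h * k] and makes [h] a unit. *)
Lemma prim_nonunitD e g h : prim_idem e -> corner e g -> corner e h ->
  ~ corner_unit e g -> ~ corner_unit e h -> ~ corner_unit e (g + h).
Proof.
move=> pe cg ch ng nh [k ck [ghk _]]; have [he ee e0 me] := pe.
have [hk _ _] := ck.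
have cgk : corner e (g * k) by exact: cornerM.
have := prim_nonunit_nilp pe cgk => /(_ _).
case: (classic (corner_unit e (g * k))) => [/(prim_unitM pe cg ck) [] // | nu] /(_ nu) gn.
have [_ egk gke] := cgk.
have := ghk; rewrite mulrDl => /eqP; rewrite addrC eq_sym -subr_eq => /eqP hkE.
have : corner_unit e (h * k).
  apply: (@prim_inv_r _ _ (\sum_(i < n) (g * k) ^+ i * e)) => //.
  - exact: cornerM.
  - apply: endo_sum => i _; apply: endoM => //; elim: (i : nat) => [|j IH]; first exact: endo1.
    by rewrite exprS; apply: endoM => //; case: cgk.
  rewrite -mulr_suml mulrA -hkE -{1}egk.
  have -> : e - e * (g * k) = - (e * (g * k - 1)) by rewrite mulrBr mulr1 opprB.
  by rewrite mulNr -(mulrA e) -subrX1 gn sub0r mulrN opprK mulr1 ee.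
by move/(prim_unitM pe ch ck) => [].
Qed.

Lemma prim_unitD e g h : prim_idem e -> corner e g -> corner e h ->
  ~ corner_unit e h -> corner_unit e (g + h) <-> corner_unit e g.
Proof.
move=> pe cg ch nh.
have nN : ~ corner_unit e (- h).
  move=> [k ck [a b]]; apply: nh; exists (- k); first exact: cornerN.
  by split; [rewrite -a mulNr mulrN | rewrite -b mulNr mulrN].
split=> [u|u]; apply: NNPP => v.
  by apply: (prim_nonunitD pe cg ch v nh).
apply: (prim_nonunitD pe (cornerD cg ch) (cornerN ch) v nN).
by rewrite addrK.
Qed.

Lemma prim_nonunit_sum e (I : Type) (r : seq I) (P : pred I) (F : I -> 'M[R]_n) : prim_idem e ->
  (forall i, P i -> corner e (F i) /\ ~ corner_unit e (F i)) ->
  ~ corner_unit e (\sum_(i <- r | P i) F i).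
Proof.
move=> pe h.
suff [] : corner e (\sum_(i <- r | P i) F i) /\ ~ corner_unit e (\sum_(i <- r | P i) F i) by [].
elim/big_ind: _ => //; first by split; [exact: corner0 | exact: prim_nonunit0].
by move=> x y [cx nx] [cy ny]; split; [exact: cornerD | exact: prim_nonunitD].
Qed.

(** Induction on the rank: an idempotent of the corner other than 0 and [e] has smaller rank than
    [e]. *)
Lemma exists_primitive e : is_endo rho e -> e * e = e -> e <> 0 ->
  exists2 f, prim_idem f & corner e f.
Proof.
have [m] := ubnP (\rank e); elim: m e => // m IH e lem he ee e0.
case: (classic (prim_idem e)) => [pe|npe]; first by exists e.
have [f [cf ff f0 fe]] : exists f, [/\ corner e f, f * f = f, f <> 0 & f <> e].
  apply: NNPP => nf; apply: npe; split => // f cf ff.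
  by apply: NNPP => /not_or_and [f0 fe]; apply: nf; exists f.
have [hf ef fe'] := cf.
have fsub : (f <= e)%MS by rewrite -[X in (X <= _)%MS]fe'; apply: submxMl.
have rf : (\rank f < \rank e)%N.
  rewrite ltn_neqAle mxrankS // andbT; apply/negP => /eqP rk.
  have : (e <= f)%MS by rewrite -(geq_leqif (mxrank_leqif_sup fsub)) rk.
  by move=> /submxP [x ex]; apply: fe; rewrite -ef ex -mulmxE -mulmxA mulmxE ff.
have [|g pg cg] := IH f _ hf ff f0; first by rewrite (leq_trans rf).
by exists g => //; apply: corner_trans cg.
Qed.

End EndomorphismRing.

(** * Equivalence of idempotents and its invariants *)

Section EquivalentIdempotents.
Local Open Scope ring_scope.
Variables (S : Type) (n : nat) (rho : S -> 'M[R]_n).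
Implicit Types e f g h u v x y : 'M[R]_n.

(** When a unit of the corner of [e] factors through [f], the image of [f] contains a copy of that
    of [e], and [v * u] projects onto it. Primitivity of [f] is not assumed because it will be
    deduced in this way for a Fitting idempotent. *)
Lemma prim_unit_factor e f x : prim_idem rho e -> is_endo rho f -> f * f = f ->
  is_endo rho x -> corner_unit rho e (e * f * x * e) ->
  exists u v, [/\ is_endo rho u /\ is_endo rho v, u * v = e, corner rho f (v * u),
    (v * u) * (v * u) = v * u & v * u <> 0].
Proof.
move=> [he ee e0 me] hf ff hx [h [hh eh _] [uh _]].
have hu : is_endo rho (e * f) by exact: endoM.
have hv : is_endo rho (f * x * e * h) by do 3 apply: endoM => //.
have uv : e * f * (f * x * e * h) = e by rewrite -[RHS]uh !mulrA -(mulrA e f f) ff.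
have vv : f * x * e * h * (e * f) * (f * x * e * h * (e * f)) = f * x * e * h * (e * f).
  by rewrite -mulrA [e * f * _]mulrA uv !mulrA -(mulrA _ e e) ee.
exists (e * f), (f * x * e * h); split => //.
  split; first exact: endoM.
    by rewrite !mulrA ff.
  by rewrite -!mulrA ff.
move: hv uv vv; set u := e * f; set v := f * x * e * h => hv uv _ vu0; apply: e0.
have E : u * (v * u) * v = e by rewrite mulrA -[LHS]mulrA uv ee.
by rewrite -E vu0 mulr0 mul0r.
Qed.

Lemma prim_unit_equiv e f x : prim_idem rho e -> prim_idem rho f -> is_endo rho x ->
  corner_unit rho e (e * f * x * e) -> equiv_idem rho e f.
Proof.
move=> pe [hf ff f0 mf] hx /(prim_unit_factor pe hf ff hx) [u [v [[hu hv] uv cvu vuvu vu0]]].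
by exists u, v; split => //; case: (mf _ cvu vuvu).
Qed.

(** Multiplying by [e] turns [u] and [v] into maps between the two images that vanish on the
    complements, so that conjugation by them respects corners. *)
Lemma equiv_idem_norm e f : e * e = e -> f * f = f -> equiv_idem rho e f ->
  is_endo rho e -> exists u v, [/\ is_endo rho u /\ is_endo rho v, u * v = e, v * u = f,
    e * u = u /\ u * f = u & f * v = v /\ v * e = v].
Proof.
move=> ee ff [u [v [hu hv uv vu]]] he.
exists (e * u), (v * e); split.
- by split; apply: endoM.
- by rewrite mulrA -(mulrA e u v) uv ee ee.
- by rewrite mulrA -(mulrA v e e) ee -uv mulrA vu -mulrA vu ff.
- by rewrite mulrA ee -mulrA -vu (mulrA u v) uv mulrA ee.
- by rewrite -mulrA ee -vu mulrA -(mulrA v u v) uv -mulrA ee.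
Qed.

Lemma equiv_idem_sym e f : equiv_idem rho e f -> equiv_idem rho f e.
Proof. by move=> [u [v [a b c d]]]; exists v, u. Qed.

Lemma equiv_idem_trans e f g : is_endo rho e -> is_endo rho f ->
  e * e = e -> f * f = f -> g * g = g ->
  equiv_idem rho e f -> equiv_idem rho f g -> equiv_idem rho e g.
Proof.
move=> he hf ee ff gg /(equiv_idem_norm ee ff) [] // u [v [[hu hv] uv vu [eu uf] [fv ve]]].
move=> /(equiv_idem_norm ff gg) [] // u' [v' [[hu' hv'] uv' vu' [eu' uf'] [fv' ve']]].
exists (u * u'), (v' * v); split; try exact: endoM.
  by rewrite mulrA -(mulrA u) uv' uf.
by rewrite mulrA -(mulrA v') vu ve'.
Qed.

Section Transfer.
Variables (e f : 'M[R]_n).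
Hypotheses (he : is_endo rho e) (ee : e * e = e) (hf : is_endo rho f) (ff : f * f = f).
Hypothesis ef : equiv_idem rho e f.

(** Conjugation [x -> u * x * v], with inverse [x -> v * x * u], identifies the corner of [f] with
    that of [e]; the next lemma rests on the same identification. *)
Lemma equiv_primitive : prim_idem rho e -> prim_idem rho f.
Proof.
have [u [v [[hu hv] uv vu [eu uf] [fv ve]]]] := equiv_idem_norm ee ff ef he.
move=> [_ _ e0 me]; split => //.
  by move=> f0; apply: e0; rewrite -uv -uf f0 mulr0 mul0r.
move=> g [hg fg gf] gg.
have gE : g = v * (u * g * v) * u by rewrite !mulrA vu -mulrA vu fg gf.
case: (me (u * g * v)).
- split; first by do 2 apply: endoM => //.
    by rewrite !mulrA eu.
  by rewrite -mulrA ve.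
- by rewrite mulrA mulrA -(mulrA _ v u) vu -(mulrA u g f) gf -(mulrA u g g) gg.
- by move=> g0; left; rewrite gE g0 mulr0 mul0r.
- by move=> g0; right; rewrite gE g0 ve vu.
Qed.

Lemma equiv_real_type : real_type rho e -> real_type rho f.
Proof.
have [u [v [[hu hv] uv vu [eu uf] [fv ve]]]] := equiv_idem_norm ee ff ef he.
have cuv x : corner rho f x -> corner rho e (u * x * v).
  move=> [hx fx xf]; split; first by do 2 apply: endoM => //.
    by rewrite !mulrA eu.
  by rewrite -mulrA ve.
have uvM x y : corner rho f x -> (u * x * v) * (u * y * v) = u * (x * y) * v.
  by move=> [_ _ xf]; rewrite !mulrA -(mulrA _ v u) vu -(mulrA u x f) xf.
move=> re g cg; have [c nu] := re _ (cuv _ cg); exists c => -[k ck [gk kg]]; apply: nu.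
have -> : u * g * v - c *: e = u * (g - c *: f) * v.
  rewrite mulrBr mulrBl; congr (_ - _).
  by rewrite -mulmxE -scalemxAr -scalemxAl mulmxE uf uv.
have cgc : corner rho f (g - c *: f) by apply: cornerB => //; apply: cornerZ.
by exists (u * k * v); [exact: cuv | rewrite !uvM // gk kg uf uv].
Qed.
End Transfer.

End EquivalentIdempotents.

(** * Diagonal blocks for a complete family of inequivalent primitive idempotents *)

Section Decomposition.
Local Open Scope ring_scope.
Variables (S : Type) (n : nat) (rho : S -> 'M[R]_n) (I : finType) (p : I -> 'M[R]_n).
Hypothesis prim_p : forall i, prim_idem rho (p i).
Hypothesis sum_p : \sum_i p i = 1.
Hypothesis nonequiv_p : forall i j, equiv_idem rho (p i) (p j) -> i = j.
Implicit Types e f g h u v x y : 'M[R]_n.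

Definition diag_unit i x := corner_unit rho (p i) (p i * x * p i).

Let hp i : is_endo rho (p i). Proof. by case: (prim_p i). Qed.
Let pp i : p i * p i = p i. Proof. by case: (prim_p i). Qed.
Let cp i x : is_endo rho x -> corner rho (p i) (p i * x * p i).
Proof. exact: corner_sandwich. Qed.

(* The terms [p_i x p_j y p_i] with [j <> i] are non-units of the corner of [p_i]: a unit
   would make [p_i] and [p_j] equivalent. *)
Lemma diag_unitM i x y : is_endo rho x -> is_endo rho y ->
  diag_unit i (x * y) <-> diag_unit i x /\ diag_unit i y.
Proof.
move=> hx hy; rewrite /diag_unit.
have -> : p i * (x * y) * p i = (p i * x * p i) * (p i * y * p i) +
    \sum_(j | j != i) p i * x * p j * y * p i.
  rewrite -[in LHS](mul1r y) -sum_p mulr_suml mulr_sumr mulr_sumr mulr_suml (bigD1 i) //=.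
  congr (_ + _); first by rewrite !mulrA -(mulrA _ (p i) (p i)) pp.
  by apply: eq_bigr => j _; rewrite !mulrA.
have cF j : corner rho (p i) (p i * x * p j * y * p i).
  have -> : p i * x * p j * y * p i = p i * (x * p j * y) * p i by rewrite !mulrA.
  by apply: cp; do 2 apply: endoM => //.
rewrite prim_unitD //; first by rewrite prim_unitM //; apply: cp.
- by apply: cornerM; apply: cp.
- by elim/big_ind: _ => //; [apply: corner0 | move=> ? ?; apply: cornerD].
- apply: prim_nonunit_sum => // j ji; split => // nu.
  have E : p i * x * p j * y * p i = (p i * x * p j) * (p j * y * p i).
    by rewrite !mulrA -(mulrA _ (p j) (p j)) pp.
  suff /nonequiv_p ij : equiv_idem rho (p i) (p j) by rewrite ij eqxx in ji.
  move: nu => [k [hk ik ki] [uk ku]].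
  have pi := prim_p i; have [_ _ pi0 _] := pi; have [_ _ pj0 mj] := prim_p j.
  exists (p i * x * p j), (p j * y * p i * k); split; try by do 3 apply: endoM => //.
    by rewrite mulrA -E.
  case: (mj (p j * y * p i * k * (p i * x * p j))).
  + split; first by do 5 apply: endoM => //; do 2 apply: endoM => //.
      by rewrite !mulrA pp.
    by rewrite -!mulrA pp.
  + rewrite mulrA -(mulrA _ (p i * x * p j)) [p i * x * p j * _]mulrA -E uk.
    by rewrite -(mulrA _ k (p i)) ki.
  + move=> z; case: pi0.
    have : (p i * x * p j) * (p j * y * p i * k * (p i * x * p j)) * (p j * y * p i * k) = p i.
      by rewrite [X in X * _]mulrA [X in X * _ * _]mulrA -E uk -mulrA [X in _ * X]mulrA -E uk pp.
    by rewrite z mulr0 mul0r => <-.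
  + by [].
Qed.

Lemma diag_unit1 i : diag_unit i 1.
Proof. by rewrite /diag_unit mulr1 pp; exists (p i) => //; rewrite pp. Qed.

Lemma diag_unit0 i : ~ diag_unit i 0.
Proof. by rewrite /diag_unit mulr0 mul0r; apply: prim_nonunit0. Qed.

Lemma diag_unitX i x k : is_endo rho x -> diag_unit i x -> diag_unit i (x ^+ k).
Proof.
move=> hx ux; suff [] : is_endo rho (x ^+ k) /\ diag_unit i (x ^+ k) by [].
elim: k => [|k [h u]]; first by split; [exact: endo1 | exact: diag_unit1].
by rewrite exprS; split; [exact: endoM | apply/diag_unitM].
Qed.

Lemma diag_unitD i x y : is_endo rho x -> is_endo rho y -> ~ diag_unit i y ->
  diag_unit i (x + y) <-> diag_unit i x.
Proof.
move=> hx hy ny; rewrite /diag_unit mulrDr mulrDl.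
by apply: prim_unitD => //; apply: cp.
Qed.

(** A Krull-Schmidt argument. A nonzero [e] contains a primitive [f = \sum_i f * p i * f]; by
    locality one term is a unit of the corner of [f], so [f] is equivalent to that [p i]. Then [p i]
    factors through [f], and multiplicativity makes block [i] of [f], hence of [e], a unit. *)
Lemma idem_no_diag e : is_endo rho e -> e * e = e -> (forall i, ~ diag_unit i e) -> e = 0.
Proof.
move=> he ee nd; apply: NNPP => e0.
have [f pf [hf ef fe]] := exists_primitive he ee e0.
have [_ ff f0 _] := pf.
have nf i : ~ diag_unit i f by rewrite -ef => /(diag_unitM _ he hf) [] /nd.
suff [i ui] : exists i, corner_unit rho f (f * p i * f).
  have /equiv_idem_norm [] // : equiv_idem rho f (p i).
    by apply: (prim_unit_equiv (x := 1)) => //; [exact: endo1 | rewrite mulr1].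
  move=> u [v [[hu hv] uv vu [fu up] [pv vf]]]; apply: (nf i).
  have : diag_unit i (p i) by rewrite /diag_unit !pp; exists (p i) => //; rewrite pp.
  by rewrite -vu -fu => /(diag_unitM _ hv (endoM hf hu)) [_ /(diag_unitM _ hf hu)] [].
apply: NNPP => h; apply: (@prim_nonunit_sum _ _ rho f I (index_enum I) predT (fun i => f * p i * f)) => //.
  move=> i _; split; first exact: corner_sandwich.
  by move=> u; apply: h; exists i.
by rewrite -mulr_suml -mulr_sumr sum_p mulr1 ff; exists f.
Qed.

Section FittingIdempotent.
Variables (x f y : 'M[R]_n).
Hypotheses (hx : is_endo rho x) (hf : is_endo rho f) (hy : is_endo rho y) (ff : f * f = f).
Hypotheses (xf : x ^+ n * f = 0) (xy : x * y = 1 - f).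

(** The blocks of [x] and [f] cannot both be units since [x ^+ n * f = 0]; if that of [f] is not,
    then that of [1 - f = x * y] is, hence that of [x]. *)
Lemma fitting_diag i : diag_unit i f <-> ~ diag_unit i x.
Proof.
split=> [uf ux|nx].
  have hxn : is_endo rho (x ^+ n).
    elim: (n in x ^+ n) => [|k IH]; first exact: endo1.
    by rewrite exprS; apply: endoM.
  apply: (@diag_unit0 i); rewrite -xf; apply/diag_unitM => //; split => //.
  exact: diag_unitX.
apply: NNPP => nf; apply: nx.
have : diag_unit i (1 - f + f) by rewrite subrK; apply: diag_unit1.
rewrite diag_unitD //; last by apply: endoB => //; apply: endo1.
by rewrite -xy => /(diag_unitM _ hx hy) [].
Qed.

Lemma fitting_unit : x \in unitmx <-> f = 0.
Proof.
split=> [ux|f0]; last first.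
  by move: xy; rewrite f0 subr0 => /mulmx1_unit [].
have: x ^+ n \in unitmx.
  elim: (n in x ^+ n) => [|k IH]; first exact: unitmx1.
  by rewrite exprS unitmx_mul ux IH.
by move=> u; rewrite -(mulKmx u f) (xf : _ *m f = 0) mulmx0.
Qed.

Lemma diag_unit_equiv i : diag_unit i f -> prim_idem rho f -> equiv_idem rho (p i) f.
Proof.
move=> uf pf; apply: (prim_unit_equiv (x := 1)) => //; first exact: endo1.
by rewrite mulr1.
Qed.

(** The unit blocks of [f] are the non-unit blocks of [x]. If [f] is primitive, it is equivalent to
    each corresponding [p i], so there is only one. Conversely, a single unit block [i] yields a
    copy of [p i] inside [f], which must exhaust [f]. *)
Lemma fitting_prim_real_type :
  f = 0 \/ (prim_idem rho f /\ real_type rho f) <->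
  (forall i, ~ diag_unit i x -> real_type rho (p i)) /\
  (forall i j, ~ diag_unit i x -> ~ diag_unit j x -> i = j).
Proof.
split=> [[f0|[pf rf]]|[rp uq]].
- by split=> [i|i j] /fitting_diag; rewrite f0 => /diag_unit0.
- have e i : ~ diag_unit i x -> equiv_idem rho (p i) f.
    by move=> /fitting_diag /diag_unit_equiv; apply.
  split=> [i /e|i j /e ei /e ej].
    by move=> /equiv_idem_sym /equiv_real_type; apply.
  by apply: nonequiv_p; apply: equiv_idem_trans ei (equiv_idem_sym ej).
- case: (classic (exists i, diag_unit i f)) => [[i ui]|h]; last first.
    by left; apply: idem_no_diag => // i ui; apply: h; exists i.
  right; suff : equiv_idem rho (p i) f.
    move=> e; split; first exact: (equiv_primitive _ _ _ _ e).
    by apply: (equiv_real_type _ _ _ _ e) => //; apply: rp; apply/fitting_diag.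
  have := ui; rewrite /diag_unit => ui'.
  have [|u [v [[hu hv] uv cvu vuvu vu0]]] := prim_unit_factor (prim_p i) hf ff (endo1 rho) _.
    by rewrite mulr1.
  (* The rest [f - g] with [g = v * u] is an idempotent whose only possible unit block is [i]. Block
     [i] of [g] is a unit and [(f - g) * g = 0], so [f - g] has no unit block and vanishes. *)
  exists u, v; split => //; apply/eqP; rewrite eq_sym -subr_eq0; apply/eqP.
  have [hg fg gf] := cvu; set g := v * u in hg fg gf vuvu *.
  have hfg : is_endo rho (f - g) by apply: endoB.
  apply: idem_no_diag => //.
    by rewrite mulrBr !mulrBl ff fg gf vuvu subrr subr0.
  move=> j uj.
  have fE : f * (f - g) = f - g by rewrite mulrBr ff fg.
  have uj' := uj; move: uj'; rewrite -fE => /(diag_unitM _ hf hfg) [ujf _].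
  have ji : j = i by apply: uq; apply/fitting_diag.
  subst j; apply: (@diag_unit0 i).
  have <- : (f - g) * g = 0 by rewrite mulrBl fg vuvu subrr.
  apply/diag_unitM => //; split => //.
  have : diag_unit i (p i) by rewrite /diag_unit !pp; exists (p i) => //; rewrite pp.
  have E : u * (g * v) = p i by rewrite /g !mulrA uv -mulrA uv pp.
  rewrite -{1}E.
  have hgv := endoM hg hv.
  by move=> /(diag_unitM _ hu hgv) [_ /(diag_unitM _ hg hv)] [].
Qed.
End FittingIdempotent.
End Decomposition.

(** * Subrepresentations as corners *)

Section Subrepresentations.
Local Open Scope ring_scope.

Lemma proj_mx_endo (S : Type) (k : nat) (a : S -> 'M[R]_k) (U V : 'M[R]_k) :
  is_subrep a U -> is_subrep a V -> (U :&: V = 0)%MS -> row_full (U + V)%MS ->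
  is_endo a (proj_mx U V) /\ proj_mx U V * proj_mx U V = proj_mx U V.
Proof.
move=> sU sV cap full; split; last exact: proj_mx_proj.
move=> s; set p := proj_mx U V; set q := proj_mx V U.
have pq : p + q = 1.
  by have := add_proj_mx cap (submx_full 1%:M full); rewrite !mul1mx.
have pa : p *m a s *m p = p *m a s.
  apply: proj_mx_id => //; apply: submx_trans (sU s).
  by apply: submxMr; rewrite -[p]mul1mx proj_mx_sub.
have qa : q *m a s *m p = 0.
  apply: proj_mx_0 => //; apply: submx_trans (sV s).
  by apply: submxMr; rewrite -[q]mul1mx proj_mx_sub.
by rewrite -[a s in LHS]mul1mx -[1%:M]pq !mulmxDl pa qa addr0.
Qed.

Lemma indecomposableP (S : Type) (k : nat) (a : S -> 'M[R]_k) :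
  indecomposable a <-> prim_idem a 1.
Proof.
split=> [[k0 ind]|[_ _ n0 pr]].
  split; [exact: endo1 | by rewrite mulr1 | |].
    by move=> /(congr1 mxrank); rewrite mxrank1 mxrank0 => E; rewrite E in k0.
  move=> h [hh _ _] hh2.
  have sub (g : 'M[R]_k) : is_endo a g -> is_subrep a g.
    by move=> hg s; have := submxMl (a s) g; rewrite (hg s).
  have hh' : is_endo a (1 - h) by apply: endoB => //; apply: endo1.
  have cap : (h :&: (1 - h))%MS = 0.
    apply/eqP; rewrite -submx0; apply/rV_subP => v; rewrite sub_capmx => /andP [/submxP [x ->] /submxP [y E]].
    rewrite -hh2 -mulmxE mulmxA E -mulmxA mulmxE mulrBl mul1r hh2 subrr mulmx0; exact: sub0mx.
  have full : (1%:M <= h + (1 - h))%MS.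
    have -> : 1%:M = h + (1 - h) :> 'M[R]_k by rewrite addrC subrK.
    by apply: addmx_sub_adds.
  case: (ind h (1 - h) (sub _ hh) (sub _ hh')).
  - by rewrite cap mxrank0.
  - by apply/eqP; move: full; rewrite sub1mx.
  - by move/eqP; rewrite mxrank_eq0 => /eqP; left.
  - by move/eqP; rewrite mxrank_eq0 subr_eq0 => /eqP <-; right.
split.
  by case: (posnP k) => // k0; case: n0; move: (1 : 'M[R]_k); rewrite k0 => e; rewrite [e]flatmx0.
move=> U V sU sV /eqP; rewrite mxrank_eq0 => /eqP cap full.
have full' : row_full (U + V)%MS by apply/eqP.
have [he ee] := proj_mx_endo sU sV cap full'.
have := proj_mx_id cap (submx_refl U); have := proj_mx_0 cap (submx_refl V).
case: (pr _ _ ee) => [|->|->]; first by split; rewrite ?mulr1 ?mul1r.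
  by rewrite !mulmx0 => _ <-; left; rewrite mxrank0.
by rewrite !mulmx1 => ->; right; rewrite mxrank0.
Qed.

(** A subspace inside [P] is enlarged one vector at a time, the codimension bounding the number of
    steps. This turns subspaces known only through a logical property, such as the nilpotent
    endomorphisms, into matrices. *)
Lemma subspace_of_pred (F : fieldType) (d : nat) (P : 'rV[F]_d -> Prop) :
  P 0 -> (forall c u v, P u -> P v -> P (c *: u + v)) ->
  exists M : 'M[F]_d, forall v, (v <= M)%MS <-> P v.
Proof.
move=> P0 PD.
suff H j (M : 'M[F]_d) : (d - \rank M <= j)%N -> (forall v, (v <= M)%MS -> P v) ->
    exists M' : 'M[F]_d, forall v, (v <= M')%MS <-> P v.
  by apply: (H d 0) => [|v]; [exact: leq_subr | rewrite submx0 => /eqP ->].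
elim: j M => [|j IH] M rM PM.
  exists M => v; split; first exact: PM.
  move=> _; apply: submx_full; rewrite /row_full eqn_leq rank_leq_row.
  by move: rM; rewrite leqn0 subn_eq0.
case: (classic (exists v, P v /\ ~~ (v <= M)%MS)) => [[v [Pv vM]]|h]; last first.
  exists M => v; split; first exact: PM.
  by move=> Pv; apply/negP => /negP nv; apply: h; exists v.
apply: (IH (M + v)%MS).
  have lt : (\rank M < \rank (M + v)%MS)%N.
    rewrite ltn_neqAle mxrankS ?addsmxSl // andbT; apply: contra vM => /eqP E.
    apply: submx_trans (addsmxSr M v) _.
    by rewrite -(geq_leqif (mxrank_leqif_sup (addsmxSl M v))) E.
  rewrite -ltnS (leq_trans _ rM) // ltn_sub2l //.
  by rewrite (leq_trans lt) // rank_leq_row.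
move=> w /sub_addsmxP [[x y] /= ->]; rewrite addrC.
have -> : y *m v = y 0 0 *: v by rewrite [y in LHS]mx11_scalar mul_scalar_mx.
by apply: PD => //; apply: PM; apply: submxMl.
Qed.

Lemma corner1 (S : Type) (k : nat) (a : S -> 'M[R]_k) g : corner a 1 g <-> is_endo a g.
Proof. by split=> [[]|h] //; split; rewrite ?mulr1 ?mul1r. Qed.

Lemma nilpotent_mxP (S : Type) (k : nat) (a : S -> 'M[R]_k) g : prim_idem a 1 ->
  is_endo a g -> nilpotent_mx g <-> ~ corner_unit a 1 g.
Proof.
move=> p1 hg; split=> [[m gm] u|nu]; last first.
  by exists k; apply: prim_nonunit_nilp nu => //; apply/corner1.
apply: (prim_nonunit0 p1); rewrite -gm; elim: m {gm} => [|m IH].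
  by exists 1; rewrite ?mulr1 //; apply/corner1/endo1.
by rewrite exprS; apply: corner_unitM.
Qed.

Lemma rank_add_row (F : fieldType) (m d : nat) (M : 'M[F]_(m, d)) (v : 'rV[F]_d) :
  ~~ (v <= M)%MS -> \rank (M + v)%MS = (\rank M).+1.
Proof.
move=> vM; apply/eqP; rewrite eqn_leq; apply/andP; split.
  apply: leq_trans (mxrank_adds_leqif M v).1 _.
  by apply: (@leq_trans (\rank M + 1)); rewrite ?leq_add2l ?rank_leq_row ?addn1.
rewrite ltn_neqAle mxrankS ?addsmxSl // andbT; apply: contra vM => /eqP E.
apply: submx_trans (addsmxSr M v) _.
by rewrite -(geq_leqif (mxrank_leqif_sup (addsmxSl M v))) E.
Qed.

(** The identity is not nilpotent, so [N] and the line it spans have a sum of rank [(\rank N).+1].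
    The rank condition therefore says that this sum is [E], that is, each endomorphism is a scalar
    plus a nilpotent. *)
Lemma abs_indecomposableP (S : Type) (k : nat) (a : S -> 'M[R]_k) :
  abs_indecomposable a <-> prim_idem a 1 /\ real_type a 1.
Proof.
have n1 : prim_idem a 1 -> ~ nilpotent_mx (1 : 'M[R]_k).
  move=> p1 /(nilpotent_mxP p1 (endo1 a)); apply.
  by exists 1; rewrite ?mulr1 //; apply/corner1/endo1.
split=> [[/indecomposableP p1 [E [N [hE [hN rk]]]]]|[p1 rt]].
  split => // g /corner1 hg.
  have NE : (N <= E)%MS.
    by apply/rV_subP => v; rewrite -(vec_mxK v) => /hN [h _]; apply/hE.
  have v1N : ~~ (mxvec 1 <= N)%MS by apply/negP => /hN [_] /(n1 p1).
  have NvE : (N + mxvec 1 <= E)%MS by rewrite addsmx_sub NE; apply/hE/endo1.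
  have EN : (E <= N + mxvec 1)%MS.
    by rewrite -(geq_leqif (mxrank_leqif_sup NvE)) rk rank_add_row.
  have /hE /submx_trans /(_ EN) /sub_addsmxP [[x y] /= gE] := hg.
  exists (y 0 0); rewrite -nilpotent_mxP //; last first.
    by apply: endoB => //; apply/endoZ/endo1.
  suff /hN [] : (mxvec (g - y 0%R 0%R *: (1%R : 'M[R]_k))%R <= N)%MS by [].
  rewrite linearB linearZ /= gE {1}[y]mx11_scalar mul_scalar_mx addrK.
  exact: submxMl.
split; first exact/indecomposableP.
have [||N hN] := @subspace_of_pred R (k * k)
    (fun v => is_endo a (vec_mx v) /\ nilpotent_mx (vec_mx v)).
- by rewrite linear0; split; [exact: endo0 | exists 1%N; rewrite expr1].
- move=> c u v [hu nu] [hv nv]; rewrite linearP /=.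
  have hcu : is_endo a (c *: vec_mx u) by apply: endoZ.
  split; first exact: endoD.
  apply/(nilpotent_mxP p1); first exact: endoD.
  apply: prim_nonunitD => //; try exact/corner1; last exact/nilpotent_mxP.
  move=> [h ch [uh _]]; move/(nilpotent_mxP p1 hu): nu; apply.
  apply: (@prim_inv_r _ _ _ _ _ (c *: h)) => //; try exact/corner1.
    by apply: endoZ; case: ch.
  by rewrite -uh -!mulmxE -scalemxAl -scalemxAr.
have v1N : ~~ (mxvec 1 <= N)%MS by apply/negP => /hN [_]; rewrite mxvecK => /(n1 p1).
have [E eE] : exists E : 'M[R]_(k * k), (E :=: (N + mxvec (1%R : 'M[R]_k))%MS)%MS.
  by exists (<<(N + mxvec (1%R : 'M[R]_k))%MS>>)%MS; apply: genmxE.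
exists E, N; split; last split.
- move=> g; rewrite eE; split.
    move=> /sub_addsmxP [[x y] /= gE].
    rewrite -(mxvecK g) gE [y]mx11_scalar mul_scalar_mx linearD linearZ /= mxvecK.
    apply: endoD; last by apply/endoZ/endo1.
    by have [] := (hN (x *m N)).1 (submxMl _ _).
  move=> hg; have [c nc] := rt g ((corner1 a g).2 hg).
  have hgc : is_endo a (g - c *: (1 : 'M[R]_k)) by apply: endoB => //; apply/endoZ/endo1.
  have -> : mxvec g = mxvec (g - c *: (1 : 'M[R]_k)) + c *: mxvec (1 : 'M[R]_k).
    by rewrite -linearZ -linearD /= subrK.
  apply: addmx_sub_adds; last exact: scalemx_sub.
  apply/hN; rewrite mxvecK; split; [exact: hgc | exact/(nilpotent_mxP p1 hgc)].
- by move=> g; rewrite hN mxvecK.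
- by rewrite eE rank_add_row.
Qed.

(** [B] includes the image of [f] and [C] projects onto it, both intertwining the actions. These
    four identities take the place of computations with the pseudo-inverse in [restrict]. *)
Lemma restrict_coords (S : Type) (n : nat) (rho : S -> 'M[R]_n) (f U : 'M[R]_n) :
  is_endo rho f -> f * f = f -> (f :=: U)%MS ->
  exists (B : 'M[R]_(\rank U, n)) (C : 'M[R]_(n, \rank U)),
    [/\ B *m C = 1%:M, C *m B = f, forall s, restrict rho U s *m B = B *m rho s
      & forall s, rho s *m C = C *m restrict rho U s].
Proof.
move=> hf ff fU.
have BU : (row_base U <= f)%MS by rewrite fU eq_row_base.
have Bf : row_base U *m f = row_base U.
  by have /submxP [x ->] := BU; rewrite -mulmxA mulmxE ff.
have BC : row_base U *m (f *m pinvmx (row_base U)) = 1%:M.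
  by rewrite mulmxA Bf mulmxVp ?row_base_free.
have CB : f *m pinvmx (row_base U) *m row_base U = f.
  by rewrite mulmxKpV // eq_row_base fU.
have sB s : restrict rho U s *m row_base U = row_base U *m rho s.
  rewrite mulmxKpV // stablemx_row_base -(eqmxMr (rho s) fU) -fU -(hf s); exact: submxMl.
exists (row_base U), (f *m pinvmx (row_base U)); split => // s.
have fC : f *m (f *m pinvmx (row_base U)) = f *m pinvmx (row_base U) by rewrite mulmxA mulmxE ff.
move: BC CB sB fC; set C := f *m pinvmx _; set B := row_base U => BC CB sB fC.
clearbody C B; move: (restrict rho U s) (sB s) => a aB.
have -> : C *m a = C *m (a *m B) *m C by rewrite -!mulmxA BC mulmx1.
by rewrite aB (mulmxA C) CB -(hf s) -mulmxA fC.
Qed.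

(** * Endomorphisms of a summand as the corner of its idempotent *)

Section CornerRestrict.
Variables (S : Type) (n k : nat) (rho : S -> 'M[R]_n) (a : S -> 'M[R]_k) (f : 'M[R]_n).
Variables (B : 'M[R]_(k, n)) (C : 'M[R]_(n, k)).
Hypotheses (BC : B *m C = 1%:M) (CB : C *m B = f).
Hypotheses (aB : forall s, a s *m B = B *m rho s) (rC : forall s, rho s *m C = C *m a s).

Let fC : f *m C = C. Proof. by rewrite -CB -mulmxA BC mulmx1. Qed.
Let Bf : B *m f = B. Proof. by rewrite -CB mulmxA BC mul1mx. Qed.

Lemma corner_up h : is_endo a h -> corner rho f (C *m h *m B).
Proof.
move=> hh; split.
- by move=> s; rewrite !mulmxA rC -(mulmxA C) hh -!mulmxA aB.
- by rewrite -mulmxE !mulmxA fC.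
- by rewrite -mulmxE -!mulmxA Bf.
Qed.

Lemma endo_down g : is_endo rho g -> is_endo a (B *m g *m C).
Proof. by move=> hg s; rewrite !mulmxA aB -(mulmxA B) hg -!mulmxA rC. Qed.

Lemma down_up h : B *m (C *m h *m B) *m C = h.
Proof. by rewrite !mulmxA BC mul1mx -mulmxA BC mulmx1. Qed.

Lemma up_down g : corner rho f g -> C *m (B *m g *m C) *m B = g.
Proof. by move=> [_ fg gf]; rewrite !mulmxA CB -mulmxA CB mulmxE fg. Qed.

Lemma upM g h : C *m (g *m h) *m B = (C *m g *m B) * (C *m h *m B).
Proof. by rewrite -mulmxE !mulmxA -(mulmxA _ B C) BC mulmx1. Qed.

Lemma downM g h : corner rho f g -> B *m (g *m h) *m C = (B *m g *m C) * (B *m h *m C).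
Proof. by move=> [_ _ gf]; rewrite -mulmxE !mulmxA -(mulmxA _ C B) CB -(mulmxA B g f) mulmxE gf. Qed.

Lemma down_inj g h : corner rho f g -> corner rho f h -> B *m g *m C = B *m h *m C -> g = h.
Proof. by move=> cg ch E; rewrite -(up_down cg) E up_down. Qed.

Lemma up_inj g h : C *m g *m B = C *m h *m B -> g = h.
Proof. by move=> E; rewrite -(down_up g) E down_up. Qed.

Hypotheses (hf : is_endo rho f) (ff : f * f = f).

Lemma down_id : B *m f *m C = 1.
Proof. by rewrite Bf BC. Qed.

Lemma prim_idem_restrict : prim_idem a 1 <-> prim_idem rho f.
Proof.
have cf : corner rho f f by exact: corner_id.
split=> [[_ _ n1 pr]|[_ _ f0 pr]]; split => //.
- by move=> f0; apply: n1; rewrite -down_id f0 mulmx0 mul0mx.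
- move=> g cg gg; have [hg _ _] := cg.
  case: (pr (B *m g *m C)).
  + exact/corner1/endo_down.
  + by rewrite -downM // mulmxE gg.
  + by move=> E; left; apply: (down_inj cg (corner0 _ _)); rewrite mulmx0 mul0mx.
  + by move=> E; right; apply: (down_inj cg cf); rewrite down_id.
- exact: endo1.
- by rewrite mulr1.
- by move=> z; apply: f0; rewrite -CB -[C]mulmx1 (z : 1%:M = 0) mulmx0 mul0mx.
- move=> h /corner1 hh hh2.
  case: (pr (C *m h *m B)); first exact: corner_up.
  + by rewrite -upM mulmxE hh2.
  + by move=> E; left; apply: up_inj; rewrite E mulmx0 mul0mx.
  + by move=> E; right; apply: up_inj; rewrite E mulmx1 CB.
Qed.

Lemma real_type_restrict : real_type a 1 <-> real_type rho f.
Proof.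
have cf : corner rho f f by exact: corner_id.
split=> rt.
  move=> g cg; have [hg _ _] := cg.
  have [c nc] := rt (B *m g *m C) ((corner1 _ _).2 (endo_down hg)).
  exists c => -[h ch [gh hg']]; apply: nc; have [hh _ _] := ch.
  have cgc : corner rho f (g - c *: f) by apply: cornerB => //; apply: cornerZ.
  have -> : B *m g *m C - c *: (1 : 'M[R]_k) = B *m (g - c *: f) *m C.
    by rewrite mulmxBr mulmxBl -scalemxAr -scalemxAl down_id.
  exists (B *m h *m C); first exact/corner1/endo_down.
  by rewrite -!downM // !mulmxE gh hg' down_id.
move=> h /corner1 hh; have [c nc] := rt _ (corner_up hh).
exists c => -[h' /corner1 hh' [hh1 h'h]]; apply: nc.
have -> : C *m h *m B - c *: f = C *m (h - c *: (1 : 'M[R]_k)) *m B.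
  by rewrite mulmxBr mulmxBl -scalemxAr -scalemxAl mulmx1 CB.
exists (C *m h' *m B); first exact: corner_up.
by rewrite -!upM !mulmxE hh1 h'h mulmx1 CB.
Qed.
End CornerRestrict.

Lemma equiv_idem_isomorphic (S : Type) (n : nat) (rho : S -> 'M[R]_n) (e f U V : 'M[R]_n) :
  is_endo rho e -> e * e = e -> (e :=: U)%MS -> is_endo rho f -> f * f = f -> (f :=: V)%MS ->
  equiv_idem rho e f -> isomorphic (restrict rho U) (restrict rho V).
Proof.
move=> he ee eU hf ff fV ef.
have [B1 [C1 [BC1 CB1 aB1 rC1]]] := restrict_coords he ee eU.
have [B2 [C2 [BC2 CB2 aB2 rC2]]] := restrict_coords hf ff fV.
have [u [v [[hu hv] uv vu [eu uf] [fv ve]]]] := equiv_idem_norm ee ff ef he.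
move: (restrict rho U) (restrict rho V) aB1 rC1 aB2 rC2 => a b aB1 rC1 aB2 rC2.
exists (B1 *m u *m C2); split.
- apply/row_freeP; exists (B2 *m v *m C1).
  have -> : B1 *m u *m C2 *m (B2 *m v *m C1) = B1 *m (u *m (C2 *m B2) *m v) *m C1.
    by rewrite !mulmxA.
  by rewrite CB2 mulmxE uf uv -CB1 mulmxA BC1 mul1mx BC1.
- apply/row_fullP; exists (B2 *m v *m C1).
  have -> : B2 *m v *m C1 *m (B1 *m u *m C2) = B2 *m (v *m (C1 *m B1) *m u) *m C2.
    by rewrite !mulmxA.
  by rewrite CB1 mulmxE ve vu -CB2 mulmxA BC2 mul1mx BC2.
- by move=> s; rewrite !mulmxA aB1 -(mulmxA B1) hu -!mulmxA rC2.
Qed.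

Lemma splitting_idempotents (S : Type) (n : nat) (rho : S -> 'M[R]_n) :
  splits_nonisomorphic_indecomposables rho ->
  exists (m : nat) (p : 'I_m -> 'M[R]_n), [/\ forall i, prim_idem rho (p i),
    \sum_i p i = 1, forall i j, equiv_idem rho (p i) (p j) -> i = j
    & forall i j, i != j -> p i * p j = 0].
Proof.
move=> [m [Us [sub dir rk ind niso]]].
pose V i := (\sum_(j | j != i) Us j)%MS.
have cap i : (Us i :&: V i = 0)%MS by exact: (mxdirect_sumsP dir).
have full i : row_full (Us i + V i)%MS.
  by apply/eqP; apply: etrans rk; rewrite [in RHS](bigD1 i).
have sV i : is_subrep rho (V i) by move=> s; rewrite sumsmxMr; apply/sumsmx_subP => j ji; exact: (submx_trans (sub j s) (sumsmx_sup j ji (submx_refl _))).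
pose p i := proj_mx (Us i) (V i).
have hp i : is_endo rho (p i) by case: (proj_mx_endo (sub i) (sV i) (cap i) (full i)).
have pp i : p i * p i = p i by case: (proj_mx_endo (sub i) (sV i) (cap i) (full i)).
have UV i j : j != i -> (Us j <= V i)%MS by move=> ji; apply: (sumsmx_sup j).
have pU i : (p i :=: Us i)%MS.
  apply/eqmxP/andP; split; first by rewrite -[p i]mul1mx proj_mx_sub.
  have {1}<- : Us i *m p i = Us i by apply: proj_mx_id => //; apply: cap.
  exact: submxMl.
have U0 i j : j != i -> Us j *m p i = 0 by move=> ji; apply: proj_mx_0 (cap i) (UV _ _ ji).
exists m, p; split.
- move=> i; have [B [C [BC CB aB rC]]] := restrict_coords (hp i) (pp i) (pU i).
  apply/(prim_idem_restrict BC CB aB rC (hp i) (pp i)).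
  exact/indecomposableP/ind.
(* [1 - \sum_i p i] kills every [Us j], and these span the space. *)
- apply/eqP; rewrite eq_sym -subr_eq0 -submx0; apply/eqP/eqP.
  have E j : Us j *m (1 - \sum_i p i) = 0.
    rewrite mulmxBr mulmx1 mulmx_sumr (bigD1 j) //= (proj_mx_id (cap j)) //.
    by rewrite big1 ?addr0 ?subrr // => i ij; apply: U0; rewrite eq_sym.
  have : (1%:M <= kermx (1 - \sum_i p i)%R)%MS.
    apply: (@submx_trans _ _ _ _ _ _ (\sum_i Us i)%MS).
      by apply: submx_full; apply/eqP.
    by apply/sumsmx_subP => i _; apply/sub_kermxP.
  by move/sub_kermxP; rewrite mul1mx => ->; rewrite sub0mx.
- move=> i j e; apply/eqP/negPn/negP => ij; apply: (niso i j ij).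
  by apply: equiv_idem_isomorphic e.
- move=> i j ij; have /submxP [x ->] : (p i <= Us i)%MS by rewrite pU.
  by rewrite -mulmxE -mulmxA U0 // mulmx0.
Qed.

Lemma separating_column (F : fieldType) (m d : nat) (N : 'M[F]_(m, d)) (v : 'rV[F]_d) :
  ~~ (v <= N)%MS -> exists w : 'cV[F]_d, N *m w = 0 /\ v *m w = 1%:M.
Proof.
rewrite submxE; have := mulmx_coker N; move: (cokermx N) => K NK /matrix0Pn [i [j nz]].
exists (((v *m K) i j)^-1 *: (K *m delta_mx j 0)); split.
  by rewrite -scalemxAr mulmxA NK mul0mx scaler0.
rewrite -scalemxAr mulmxA -colE; apply/matrixP => a b; rewrite [i]ord1 in nz *.
by rewrite [a]ord1 [b]ord1 [LHS]mxE [X in _ * X]mxE mulVf // mxE.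
Qed.

Definition linform (n : nat) (phi : 'M[R]_n -> R) :=
  forall (c : R) X Y, phi (c *: X + Y) = c * phi X + phi Y.

(** * Linear forms vanishing on the non-units of a corner *)

Section Functionals.
Variables (S : Type) (n : nat) (rho : S -> 'M[R]_n).

Lemma nonunit_space p : prim_idem rho p -> exists N : 'M[R]_(n * n),
  forall v, (v <= N)%MS <-> corner rho p (vec_mx v) /\ ~ corner_unit rho p (vec_mx v).
Proof.
move=> pp; apply: subspace_of_pred => [|c u v [cu nu] [cv nv]].
  by rewrite linear0; split; [exact: corner0 | exact: prim_nonunit0].
rewrite linearP /=; have cc := cornerZ c cu; split; first exact: cornerD.
apply: prim_nonunitD => // -[h ch [uh _]]; apply: nu.
apply: (@prim_inv_r _ _ _ _ _ (c *: h)) => //; first by apply: endoZ; case: ch.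
by rewrite -uh -!mulmxE -scalemxAl -scalemxAr.
Qed.

Definition corner_form (p : 'M[R]_n) (w : 'cV[R]_(n * n)) (X : 'M[R]_n) : R :=
  (mxvec (p * X * p) *m w) 0 0.

Lemma corner_form_lin p w : linform (corner_form p w).
Proof.
move=> c X Y; rewrite /corner_form mulrDr mulrDl -mulmxE -scalemxAr -scalemxAl.
by rewrite linearD linearZ /= mulmxDl -scalemxAl !mxE.
Qed.

Lemma corner_form_corner p w X : corner rho p X -> corner_form p w X = (mxvec X *m w) 0 0.
Proof. by move=> [_ pX Xp]; rewrite /corner_form pX Xp. Qed.

Lemma corner_form_orth p q w X : p * q = 0 -> corner rho q X -> corner_form p w X = 0.
Proof.
by move=> pq [_ qX _]; rewrite /corner_form -qX mulrA pq !mul0r linear0 mul0mx mxE.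
Qed.

(** The form separates the block of [X] from the subspace of non-units, so that [phi Y != 0]
    certifies a unit block of [Y]: being a unit becomes an open condition. *)
Lemma diag_unit_form (I : finType) (p : I -> 'M[R]_n) (i : I) X : prim_idem rho (p i) ->
  is_endo rho X -> diag_unit rho p i X ->
  exists phi, [/\ linform phi, phi X != 0
    & forall Y, is_endo rho Y -> ~ diag_unit rho p i Y -> phi Y = 0].
Proof.
move=> pi hX uX; have [N hN] := nonunit_space pi; have [hp pp _ _] := pi.
have [|w [Nw Xw]] := @separating_column _ _ _ N (mxvec (p i * X * p i)).
  by apply/negP => /hN [_]; rewrite mxvecK.
exists (corner_form (p i) w); split; first exact: corner_form_lin.
  by rewrite /corner_form Xw mxE eqxx oner_eq0.
move=> Y hY nY; have : (mxvec (p i * Y * p i) <= N)%MS.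
  by apply/hN; rewrite mxvecK; split => //; apply: corner_sandwich.
by move=> /submxP [x E]; rewrite /corner_form E -mulmxA Nw mulmx0 mxE.
Qed.

(** Modulo non-units [p] is nonzero, which gives [w]. If the type is not real, some [z] has all
    [z - c *: p] units, so it is independent of [p] modulo non-units, which gives [w']. Both forms
    vanish when the block is nilpotent: these are the two equations for a block of non-real type. *)
Lemma corner_dual_forms p : prim_idem rho p ->
  exists (w w' : 'cV[R]_(n * n)) (z : 'M[R]_n),
  [/\ corner rho p z, corner_form p w p = 1,
      forall X, is_endo rho X -> ~ corner_unit rho p (p * X * p) -> corner_form p w X = 0
   & ~ real_type rho p -> [/\ corner_form p w z = 0, corner_form p w' p = 0,
      corner_form p w' z = 1 &
      forall X, is_endo rho X -> ~ corner_unit rho p (p * X * p) -> corner_form p w' X = 0]].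
Proof.
move=> prp; have [N hN] := nonunit_space prp; have [hp pp _ _] := prp.
have cp : corner rho p p by exact: corner_id.
have vanish w : N *m w = 0 -> forall X, is_endo rho X -> ~ corner_unit rho p (p * X * p) ->
    corner_form p w X = 0.
  move=> Nw Y hY nY; have : (mxvec (p * Y * p) <= N)%MS.
    by apply/hN; rewrite mxvecK; split => //; apply: corner_sandwich.
  by move=> /submxP [x E]; rewrite /corner_form E -mulmxA Nw mulmx0 mxE.
have [|w [Nw pw]] := @separating_column _ _ _ N (mxvec p).
  by apply/negP => /hN []; rewrite mxvecK => _; apply; exists p.
case: (classic (real_type rho p)) => [rt|nrt].
  (* For real type the last clause is vacuous; [0] and [p] are placeholders for [w'] and [z]. *)
  exists w, 0, p; split => //; last exact: vanish.
  by rewrite corner_form_corner // pw mxE eqxx.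
have [z [cz uz]] : exists z, corner rho p z /\ forall c : R, corner_unit rho p (z - c *: p).
  apply: NNPP => h; apply: nrt => g cg; apply: NNPP => h'; apply: h; exists g; split => // c.
  by apply: NNPP => h''; apply: h'; exists c.
have [|w' [Nw' zw']] := @separating_column _ _ _ (N + mxvec p)%MS (mxvec z).
  apply/negP => /sub_addsmxP [[x y] /= E].
  have : (mxvec (z - y 0%R 0%R *: p)%R <= N)%MS.
    rewrite linearB linearZ /= E {1}[y]mx11_scalar mul_scalar_mx addrK; exact: submxMl.
  by move=> /hN []; rewrite mxvecK => _; apply.
have Nw'0 : N *m w' = 0.
  by have /submxP [x ->] := addsmxSl N (mxvec p); rewrite -mulmxA Nw' mulmx0.
have pw'0 : mxvec p *m w' = 0.
  by have /submxP [x ->] := addsmxSr N (mxvec p); rewrite -mulmxA Nw' mulmx0.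
(* Subtracting this multiple of [w'] makes the first form vanish at [z] and keeps its value at [p],
   where [w'] vanishes. *)
exists (w - (mxvec z *m w) 0 0 *: w'), w', z; split => //.
- by rewrite corner_form_corner // mulmxBr -scalemxAr pw pw'0 scaler0 subr0 mxE eqxx.
- by apply: vanish; rewrite mulmxBr -scalemxAr Nw Nw'0 scaler0 subr0.
- move=> _; split; last exact: vanish.
  + by rewrite corner_form_corner // mulmxBr -scalemxAr zw' !mxE /= mulr1 subrr.
  + by rewrite corner_form_corner // pw'0 mxE.
  + by rewrite corner_form_corner // zw' mxE eqxx.
Qed.
End Functionals.

Definition good (S : Type) (n : nat) (rho : S -> 'M[R]_n) (X : 'M[R]_n) : Prop :=
  X \in unitmx \/ abs_indecomposable (restrict rho (gen_kernel X)).

(** * Good endomorphisms in terms of their diagonal blocks *)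

Section Good.
Variables (S : Type) (n : nat) (rho : S -> 'M[R]_n) (m : nat) (p : 'I_m -> 'M[R]_n).
Hypotheses (prim_p : forall i, prim_idem rho (p i)) (sum_p : \sum_i p i = 1).
Hypothesis nonequiv_p : forall i j, equiv_idem rho (p i) (p j) -> i = j.
Hypothesis orth_p : forall i j, i != j -> p i * p j = 0.

Lemma goodP X : is_endo rho X -> good rho X <->
  (forall i, ~ diag_unit rho p i X -> real_type rho (p i)) /\
  (forall i j, ~ diag_unit rho p i X -> ~ diag_unit rho p j X -> i = j).
Proof.
move=> hX; have [f [h [[hf hh] ff xf xh [fk _]]]] := fitting hX.
rewrite -(fitting_prim_real_type prim_p sum_p nonequiv_p hX hf hh ff xf xh).
rewrite /good (fitting_unit xf xh).
have [B [C [BC CB aB rC]]] := restrict_coords hf ff fk.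
by rewrite abs_indecomposableP (prim_idem_restrict BC CB aB rC) // (real_type_restrict BC CB aB rC).
Qed.

(** Unit blocks of [X] stay units in [Y], so the non-unit blocks of [Y] are among those of [X] and
    inherit both conditions of [goodP]. At a non-unit block of [X] nothing is required of [Y]. *)
Lemma good_open_forms X : is_endo rho X -> good rho X ->
  exists phi : 'I_m -> 'M[R]_n -> R, (forall i, linform (phi i)) /\
    forall Y, is_endo rho Y -> (forall i, phi i X != 0 -> phi i Y != 0) -> good rho Y.
Proof.
move=> hX gX.
have /ClassicalEpsilon.choice [phi hphi] : forall i, exists phi : 'M[R]_n -> R,
    linform phi /\ (diag_unit rho p i X -> phi X != 0 /\
     forall Y, is_endo rho Y -> ~ diag_unit rho p i Y -> phi Y = 0).
  move=> i; case: (classic (diag_unit rho p i X)) => [u|nu].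
    by have [phi [a b c]] := diag_unit_form (prim_p i) hX u; exists phi.
  by exists (fun=> 0); split => // c Y Z; rewrite mulr0 addr0.
exists phi; split => // [i|Y hY h]; first by case: (hphi i).
have sub i : ~ diag_unit rho p i Y -> ~ diag_unit rho p i X.
  move=> nY u; have [_ /(_ u) [a b]] := hphi i.
  by move: (h i a); rewrite b ?eqxx.
have [rt uq] := (goodP hX).1 gX; apply/(goodP hY); split.
  by move=> i /sub /rt.
by move=> i j /sub hi /sub hj; apply: uq.
Qed.

(* The forms [(i, false)] and [(i, true)] are dual, modulo the non-units of the corner of
   [p i], to [p i] and, when [p i] is not of real type, to some [z] independent of [p i]. *)
Lemma bad_forms : exists (valid : pred ('I_m * bool)) (phi : 'I_m * bool -> 'M[R]_n -> R)
    (P : 'I_m * bool -> 'M[R]_n),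
  [/\ forall k, linform (phi k), forall k, is_endo rho (P k),
      forall k l, valid k -> valid l -> phi k (P l) = (k == l)%:R
    & forall X, is_endo rho X -> ~ good rho X ->
        exists k l, [/\ valid k, valid l, k != l, phi k X = 0 & phi l X = 0]].
Proof.
pose D := ('cV[R]_(n * n) * 'cV[R]_(n * n) * 'M[R]_n)%type.
have /ClassicalEpsilon.choice [d hd] : forall i, exists d : D,
  [/\ corner rho (p i) d.2, corner_form (p i) d.1.1 (p i) = 1,
      forall X, is_endo rho X -> ~ diag_unit rho p i X -> corner_form (p i) d.1.1 X = 0
   & ~ real_type rho (p i) -> [/\ corner_form (p i) d.1.1 d.2 = 0,
      corner_form (p i) d.1.2 (p i) = 0,
      corner_form (p i) d.1.2 d.2 = 1 &
      forall X, is_endo rho X -> ~ diag_unit rho p i X -> corner_form (p i) d.1.2 X = 0]].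
  move=> i; have [w [w' [z h]]] := corner_dual_forms (prim_p i); by exists (w, w', z).
pose realb i : bool := if excluded_middle_informative (real_type rho (p i)) then true else false.
have realP i : reflect (real_type rho (p i)) (realb i).
  by rewrite /realb; case: excluded_middle_informative => h; constructor.
(* The index [(i, true)] is discarded when [p i] is of real type, its form and vector being
   placeholders then. *)
exists (fun k => ~~ (k.2 && realb k.1)).
exists (fun k => corner_form (p k.1) (if k.2 then (d k.1).1.2 else (d k.1).1.1)).
exists (fun k => if k.2 then (d k.1).2 else p k.1).
have cP (k : 'I_m * bool) : corner rho (p k.1) (if k.2 then (d k.1).2 else p k.1).
  case: k.2; first by case: (hd k.1).
  by have [hp pp _ _] := prim_p k.1; apply: corner_id.
split.
- by move=> k; apply: corner_form_lin.
- by move=> k; case: (cP k).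
- move=> [i b] [j c] /= vb vc; case: (eqVneq i j) => [ij|ij]; last first.
    rewrite xpair_eqE (negbTE ij) /=.
    exact: (corner_form_orth _ (orth_p ij) (cP (j, c))).
  subst j; rewrite xpair_eqE eqxx /=.
  have [cz w1 _ nr] := hd i.
  case: b vb => /= vb; case: c vc => /= vc; try by case: (nr _) => //; apply/realP.
  by rewrite w1.
- move=> X hX /(goodP hX) ng.
  case: (classic (exists i, ~ diag_unit rho p i X /\ ~ real_type rho (p i))) => [[i [nu nr]]|h1].
    have [_ _ f1 /(_ nr) [_ _ _ f2]] := hd i.
    exists (i, false), (i, true); split => //=; [exact/realP | by rewrite xpair_eqE andbF | |].
      exact: f1.
    exact: f2.
  case: (classic (exists i j, [/\ ~ diag_unit rho p i X, ~ diag_unit rho p j X & i != j])) => [[i [j [ni nj ij]]]|h2].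
    have [_ _ fi _] := hd i; have [_ _ fj _] := hd j.
    exists (i, false), (j, false); split => //=; first by rewrite xpair_eqE (negbTE ij).
      exact: fi.
    exact: fj.
  exfalso; apply: ng; split.
    by move=> i nu; apply: NNPP => nr; apply: h1; exists i.
  by move=> i j ni nj; apply/eqP/negPn/negP => ij; apply: h2; exists i, j.
Qed.
End Good.

End Subrepresentations.

(** * Small functions and planar curves *)

Section Analysis.
Local Open Scope R_scope.

Lemma continuous_primitive (m : R -> R) : (forall x, continuity_pt m x) ->
  exists F, F 0 = 0 /\ forall x, derivable_pt_lim F x (m x).
Proof.
move=> cm; pose V := Hierarchy.R_CompleteNormedModule.
exists (fun x => @RInt.RInt V m 0 x); split; first exact: (@RInt.RInt_point V).
move=> x; apply/Derive.is_derive_Reals; apply: (@RInt_analysis.is_derive_RInt Hierarchy.R_NormedModule m _ 0).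
  exists (mkposreal 1 Rlt_0_1) => y _; apply: (@RInt.RInt_correct V).
  by apply: (@RInt.ex_RInt_continuous V) => z _; apply/Hierarchy.continuity_pt_filterlim; apply: cm.
by apply/Hierarchy.continuity_pt_filterlim; apply: cm.
Qed.

Lemma lipschitz1_continuity (f : R -> R) x (d : R) : 0 < d ->
  (forall y, Rabs (y - x) < d -> Rabs (f y - f x) <= Rabs (y - x)) -> continuity_pt f x.
Proof.
move=> d0 h e e0; exists (Rmin d e); split; first exact: Rmin_pos.
move=> y [_]; rewrite /= /Rdist => yx.
have h1 := Rmin_l d e; have h2 := Rmin_r d e.
by have := h y; lra.
Qed.

Lemma exists_inf (Y : Type) (P : Y -> Prop) (g : R -> Y -> R) : (exists y, P y) ->
  (forall s y, P y -> 0 <= g s y) ->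
  exists m : R -> R, (forall s y, P y -> m s <= g s y) /\
    (forall s b, (forall y, P y -> b <= g s y) -> b <= m s).
Proof.
move=> [y0 Py0] g0.
suff /ClassicalEpsilon.choice [m hm] : forall s, exists m, (forall y, P y -> m <= g s y) /\
    forall b, (forall y, P y -> b <= g s y) -> b <= m.
  by exists m; split=> s; case: (hm s).
move=> s; pose E z := exists2 y, P y & z = - g s y.
have [] := completeness E.
- by exists 0 => z [y Py ->]; have := g0 s y Py; lra.
- by exists (- g s y0), y0.
move=> M [ub lub]; exists (- M); split.
  by move=> y Py; have : E (- g s y) by [exists y]; move=> /ub; lra.
move=> b hb; have : M <= - b by apply: lub => z [y Py ->]; have := hb y Py; lra.
lra.
Qed.

(* With [sg x = (x - l0)(l1 - x)], the regularization [m s = inf_y (eps y + max 0 (s - sg y))]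
   is nondecreasing, 1-Lipschitz and [m (sg x) <= eps x]; a multiple of its primitive,
   composed with [sg], does the job. *)
Lemma small_C1_function (l0 l1 : R) (eps : R -> R) : l0 < l1 -> pos_cont_fun l0 l1 eps ->
  exists phi phi' : R -> R, forall x, in_interval l0 l1 x ->
    [/\ 0 < phi x < eps x, derivable_pt_lim phi x (phi' x), Rabs (phi' x) < eps x
      & continuity_pt phi' x].
Proof.
move=> hl he; pose I := in_interval l0 l1.
pose sg y := (y - l0) * (l1 - y).
have [||m [m1 m2]] := @exists_inf R I (fun s y => eps y + Rmax 0 (s - sg y)).
- by exists ((l0 + l1) / 2); rewrite /I /in_interval; lra.
- by move=> s y Iy; have [] := he y Iy; have := Rmax_l 0 (s - sg y); lra.
have mono s t : s <= t -> m s <= m t.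
  move=> st; apply: m2 => y Iy; apply: Rle_trans (m1 s y Iy) _.
  by apply: Rplus_le_compat_l; apply: Rle_max_compat_l; lra.
have lip s t : s <= t -> m t <= m s + (t - s).
  move=> st; suff : m t - (t - s) <= m s by lra.
  apply: m2 => y Iy; have := m1 t y Iy.
  by have := Rmax_l 0 (s - sg y); have := Rmax_r 0 (s - sg y); rewrite /Rmax; case: Rle_dec; case: Rle_dec; lra.
have mc x : continuity_pt m x.
  apply: (@lipschitz1_continuity _ _ 1); first lra.
  move=> y _; case: (Rle_dec x y) => xy.
    have a := mono _ _ xy; have b := lip _ _ xy; rewrite !Rabs_pos_eq; lra.
  have yx : y <= x by lra.
  have a := mono _ _ yx; have b := lip _ _ yx; rewrite !Rabs_left1; lra.
have sgpos x : I x -> 0 < sg x by move=> [a b]; rewrite /sg; apply: Rmult_lt_0_compat; lra.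
have mpos s : 0 < s -> 0 < m s.
  (* Outside [[al, be]] one has [sg y <= s / 2], so the penalty is at least [s / 2]; on this compact
     interval [eps] has a positive minimum. *)
  move=> s0; set al := l0 + s / (2 * (l1 - l0)); set be := l1 - s / (2 * (l1 - l0)).
  have ql : 0 < s / (2 * (l1 - l0)) by apply: Rdiv_lt_0_compat; lra.
  have qe : s / (2 * (l1 - l0)) * (l1 - l0) = s / 2 by field; lra.
  have out y : I y -> y < al \/ be < y -> s / 2 <= s - sg y.
    move=> [a b] h; suff : sg y <= s / (2 * (l1 - l0)) * (l1 - l0) by rewrite qe; lra.
    rewrite /sg; case: h => h; rewrite /al /be in h.
      by apply: Rmult_le_compat; lra.
    by rewrite Rmult_comm; apply: Rmult_le_compat; lra.
  case: (Rle_dec al be) => ab; last first.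
    apply: (Rlt_le_trans _ (s / 2)); first lra.
    apply: m2 => y Iy; have [e0 _] := he y Iy.
    have := Rmax_r 0 (s - sg y); have := out y Iy; case: (Rlt_dec y al) => ya; first lra.
    by lra.
  have [c [cmin [c1 c2]]] : exists c, (forall y, al <= y <= be -> eps c <= eps y) /\ al <= c <= be.
    apply: continuity_ab_min => // c hc.
    by have [] : 0 < eps c /\ continuity_pt eps c by apply: he; rewrite /in_interval; rewrite /al /be in hc; lra.
  have [ec _] : 0 < eps c /\ continuity_pt eps c.
    by apply: he; rewrite /in_interval; rewrite /al in c1; rewrite /be in c2; lra.
  apply: (Rlt_le_trans _ (Rmin (s / 2) (eps c))); first by apply: Rmin_pos; lra.
  apply: m2 => y Iy; have [e0 _] := he y Iy.
  have := Rmin_l (s / 2) (eps c); have := Rmin_r (s / 2) (eps c).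
  have := Rmax_r 0 (s - sg y); have := Rmax_l 0 (s - sg y).
  have := out y Iy; have := cmin y.
  case: (Rlt_dec y al) => ya; first lra.
  by case: (Rlt_dec be y) => yb; lra.
have msg x : I x -> m (sg x) <= eps x.
  move=> Ix; have := m1 (sg x) x Ix.
  by rewrite (_ : sg x - sg x = 0) ?Rmax_left; lra.
have [F [F0 dF]] := continuous_primitive mc.
have Fb s : 0 < s -> 0 < F s <= s * m s.
  move=> s0; have [|c [Ec [c0 cs]]] := MVT_cor2 F m 0 s s0; first by move=> c _; apply: dF.
  have mc0 := mpos c c0; have mcs : m c <= m s by apply: mono; lra.
  rewrite F0 !Rminus_0_r in Ec; rewrite Ec Rmult_comm; split; first exact: Rmult_lt_0_compat.
  by apply: Rmult_le_compat_l; lra.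
(* [sg] is at most [l * l] and its derivative at most [l] in absolute value; [K] is twice a common
   bound, the factor 2 giving strict inequalities. *)
pose l := l1 - l0; pose K := 2 * (l * l + l + 1).
have lp : 0 < l by rewrite /l; lra.
have ll : 0 < l * l by apply: Rmult_lt_0_compat.
have Kp : 0 < / K by apply: Rinv_0_lt_compat; rewrite /K; lra.
have KK : / K * K = 1 by apply: Rinv_l; rewrite /K; lra.
have kb a b e : 0 < e -> 0 <= b <= l * l + l + 1 -> 0 <= a <= e -> / K * (a * b) < e.
  move=> e0 hb ha.
  have : a * b <= e * (l * l + l + 1) by apply: Rmult_le_compat; lra.
  move=> h; apply: (Rle_lt_trans _ (/ K * (e * (l * l + l + 1)))).
    by apply: Rmult_le_compat_l; lra.
  have -> : / K * (e * (l * l + l + 1)) = e * (/ K * K) / 2 by rewrite /K; field; lra.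
  by rewrite KK; lra.
exists (fun x => / K * F (sg x)), (fun x => / K * (m (sg x) * (l0 + l1 - 2 * x))) => x Ix.
have [ex _] := he x Ix; have [xa xb] := Ix.
have sx := sgpos x Ix; have [F1 F2] := Fb _ sx; have m0 := mpos _ sx; have me := msg x Ix.
have sl : sg x <= l * l by rewrite /sg; apply: Rmult_le_compat; rewrite /l; lra.
have dsg y : derivable_pt_lim sg y (l0 + l1 - 2 * y).
  have -> : l0 + l1 - 2 * y = (1 - 0) * (l1 - y) + (y - l0) * (0 - 1) by ring.
  apply: derivable_pt_lim_mult; apply: derivable_pt_lim_minus;
    by [apply: derivable_pt_lim_id | apply: derivable_pt_lim_const].
split.
- split; first exact: Rmult_lt_0_compat.
  apply: (Rle_lt_trans _ (/ K * (m (sg x) * sg x))).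
    by apply: Rmult_le_compat_l; lra.
  by apply: kb; lra.
- apply: derivable_pt_lim_scal.
  exact: (derivable_pt_lim_comp sg F x _ _ (dsg x) (dF _)).
- rewrite !Rabs_mult (Rabs_pos_eq (/ K)); last lra.
  rewrite (Rabs_pos_eq (m _)); last lra.
  apply: kb; try lra; split; first exact: Rabs_pos.
  by apply: (Rle_trans _ l); [apply: Rabs_le; rewrite /l; lra | lra].
- apply: continuity_pt_mult; first by apply: continuity_pt_const.
  apply: continuity_pt_mult.
    apply: (continuity_pt_comp sg m x) => //.
    by apply: derivable_continuous_pt; exists (l0 + l1 - 2 * x); apply: dsg.
  apply: continuity_pt_minus; first by apply: continuity_pt_const.
  apply: continuity_pt_mult; first by apply: continuity_pt_const.
  by apply: derivable_continuous_pt; apply: derivable_pt_id.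
Qed.
End Analysis.

(** * Points of the unit square off countably many plane curves *)

Section Avoidance.
Local Open Scope R_scope.

Lemma Rabs_le_bounds (x a : R) : Rabs x <= a -> - a <= x <= a.
Proof. by split_Rabs; lra. Qed.

(** A closed interval of length [3 * eta] contains at most four multiples of [eta], counted from the
    least one [c0]. *)
Lemma near_multiples (y eta : R) : 0 < eta -> exists c0 : nat, forall c : nat,
  Rabs (y - INR c * eta) <= 3 / 2 * eta -> (c0 <= c < c0 + 4)%N.
Proof.
move=> e0; pose P c := Rabs (y - INR c * eta) <= 3 / 2 * eta.
case: (classic (exists c, P c)) => [[c1 Pc1]|h]; last by exists 0%N => c Pc; case: h; exists c.
have [c0 [[Pc0 min] _]] := dec_inh_nat_subset_has_unique_least_element P (fun c => classic (P c)) (ex_intro P c1 Pc1).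
exists c0 => c Pc; have c0c : (c0 <= c)%N by apply/leP; apply: min.
rewrite c0c ltnNge; apply/negP => /leP le.
have := le_INR _ _ le; rewrite plus_INR /= => le'.
have [_ a1] : - (3 / 2 * eta) <= y - INR c0 * eta <= 3 / 2 * eta.
  by apply/Rabs_le_bounds.
have [a2 _] : - (3 / 2 * eta) <= y - INR c * eta <= 3 / 2 * eta by apply/Rabs_le_bounds.
nra.
Qed.

(* Cut the square into [q ^ 2] cells and the curve into [N ~ k q] arcs shorter than a cell:
   each arc meets at most [16] cells, so some cell is missed once [q > 16 k + 16]. *)
Lemma square_minus_curve (f g : R -> R) (a b Lam u v w : R) : 0 < w -> 0 <= Lam ->
  (forall x y, a <= x <= b -> a <= y <= b -> Rabs (f x - f y) <= Lam * Rabs (x - y)) ->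
  (forall x y, a <= x <= b -> a <= y <= b -> Rabs (g x - g y) <= Lam * Rabs (x - y)) ->
  exists u' v' w', [/\ 0 < w', u <= u' /\ u' + w' <= u + w, v <= v' /\ v' + w' <= v + w
    & forall x, a <= x <= b -> ~ (u' <= f x <= u' + w' /\ v' <= g x <= v' + w')].
Proof.
move=> w0 L0 Lf Lg; case: (Rle_dec a b) => ab; last first.
  by exists u, v, w; split; try lra; move=> x; lra.
have [k hk] : exists k : nat, Lam * (b - a) <= INR k.+1 * w.
  have [k hk] := INR_unbounded (Lam * (b - a) / w).
  exists k; have : Lam * (b - a) = Lam * (b - a) / w * w by field; lra.
  by move=> ->; rewrite S_INR; nra.
(* By the choice of [k], a step of length [tau] moves [f] and [g] by at most the cell side [eta].
   The 17 makes the number of cells, [q ^ 2 = 16 N + 17 q], exceed the [16 (N + 1)] that can be hit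
   from the [N + 1] sample points. *)
pose q := (16 * k.+1 + 17)%N; pose N := (k.+1 * q)%N.
have q0 : 0 < INR q by apply: lt_0_INR; apply/ltP; rewrite /q addnS.
have N0 : 0 < INR N by apply: lt_0_INR; apply/ltP; rewrite /N muln_gt0 /q addnS.
pose eta := w / INR q; have eta0 : 0 < eta by apply: Rdiv_lt_0_compat.
have qeta : INR q * eta = w by rewrite /eta; field; lra.
pose tau := (b - a) / INR N.
have tau0 : 0 <= tau by apply: Rmult_le_pos; [lra | apply/Rlt_le/Rinv_0_lt_compat].
have Ntau : INR N * tau = b - a by rewrite /tau; field; lra.
have Ltau : Lam * tau <= eta.
  apply: (Rmult_le_reg_l (INR N)) => //.
  have -> : INR N * (Lam * tau) = Lam * (INR N * tau) by ring.
  rewrite Ntau /N mult_INR Rmult_assoc qeta //.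
pose xs (i : nat) := a + INR i * tau.
have sample M x : a <= x <= a + INR M * tau -> exists2 i : nat, (i <= M)%N & xs i <= x <= xs i + tau.
  elim: M => [|M IH]; first by rewrite /= => h; exists 0%N => //; rewrite /xs /=; lra.
  rewrite S_INR => h; case: (Rle_dec x (a + INR M * tau)) => xM.
    by have [|i iM hi] := IH; [lra | exists i => //; apply: leqW].
  by exists M => //; rewrite /xs; lra.
have xsab i : (i <= N)%N -> a <= xs i <= b.
  move=> /leP /le_INR iN; have := pos_INR i; rewrite /xs => i0; split; first nra.
  have : INR i * tau <= INR N * tau by apply: Rmult_le_compat_r.
  by rewrite Ntau; lra.
(* A cell met by the arc starting at [xs i] has its centre within [eta / 2 + eta] of the sample
   point in each coordinate: four columns and four rows are possible. *)
have /ClassicalEpsilon.choice [c0 hc0] := fun i => near_multiples (f (xs i) - u - eta / 2) eta0.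
have /ClassicalEpsilon.choice [d0 hd0] := fun i => near_multiples (g (xs i) - v - eta / 2) eta0.
pose hit (z : 'I_q * 'I_q) := exists x, a <= x <= b /\
  (u + INR z.1 * eta <= f x <= u + INR z.1 * eta + eta /\
   v + INR z.2 * eta <= g x <= v + INR z.2 * eta + eta).
have [[c d] nh] : exists z, ~ hit z.
  apply: NNPP => h0.
  have allhit z : hit z by apply: NNPP => nz; apply: h0; exists z.
  (* If every cell were hit, a cell could be encoded by an arc and two offsets below 4,
     contradicting the count. *)
  have /ClassicalEpsilon.choice [phi hphi] : forall z : 'I_q * 'I_q,
      exists t : 'I_N.+1 * 'I_4 * 'I_4, (z.1 = c0 t.1.1 + t.1.2 :> nat)%N /\ (z.2 = d0 t.1.1 + t.2 :> nat)%N.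
    move=> z; have [x [xab [hf hg]]] := allhit z.
    have [|i iN hi] := sample N x; first by rewrite Ntau; lra.
    have xi := xsab i iN.
    have dx : Rabs (xs i - x) <= tau by apply: Rabs_le; lra.
    have le y1 y2 : Rabs (y1 - y2) <= Lam * Rabs (xs i - x) -> - eta <= y1 - y2 <= eta.
      move=> h; apply: Rabs_le_bounds; apply: Rle_trans h _; apply: Rle_trans Ltau.
      exact: Rmult_le_compat_l.
    have df := le _ _ (Lf _ _ xi xab); have dg := le _ _ (Lg _ _ xi xab).
    have /andP [cl cr] : (c0 i <= z.1 < c0 i + 4)%N by apply: hc0; apply: Rabs_le; lra.
    have /andP [dl dr] : (d0 i <= z.2 < d0 i + 4)%N by apply: hd0; apply: Rabs_le; lra.
    have j1 : (z.1 - c0 i < 4)%N by rewrite ltn_subLR.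
    have j2 : (z.2 - d0 i < 4)%N by rewrite ltn_subLR.
    have iN' : (i < N.+1)%N by [].
    by exists (Ordinal iN', Ordinal j1, Ordinal j2); rewrite /= !subnKC.
  have inj : injective phi.
    move=> z z' e; have [a1 a2] := hphi z; have [b1 b2] := hphi z'.
    move: z z' e a1 a2 b1 b2 => [z1 z2] [z1' z2'] /= e a1 a2 b1 b2.
    by congr (_, _); apply: val_inj; rewrite /= ?a1 ?a2 ?b1 ?b2 e.
  have := leq_card phi inj; rewrite !card_prod !card_ord => /leP.
  rewrite /N /q -!multE -!plusE; nia.
exists (u + INR c * eta), (v + INR d * eta), eta.
have bound (j : 'I_q) : 0 <= INR j * eta /\ INR j * eta + eta <= w.
  have /leP /le_INR := ltn_ord j; rewrite S_INR => h; have := pos_INR j; rewrite -qeta => h'.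
  by split; nra.
have bc := bound c; have bd := bound d.
split => //; try lra.
by move=> x xab h; apply: nh; exists x.
Qed.

(** Nested closed squares, the one of rank [j + 1] missing the curve [j]; completeness provides a
    point common to all of them. *)
Lemma avoid_curves (f g : nat -> R -> R) (a b Lam : nat -> R) :
  (forall j, 0 <= Lam j) ->
  (forall j x y, a j <= x <= b j -> a j <= y <= b j ->
     Rabs (f j x - f j y) <= Lam j * Rabs (x - y)) ->
  (forall j x y, a j <= x <= b j -> a j <= y <= b j ->
     Rabs (g j x - g j y) <= Lam j * Rabs (x - y)) ->
  exists s t, [/\ 0 <= s <= 1, 0 <= t <= 1 &
    forall j x, a j <= x <= b j -> ~ (f j x = s /\ g j x = t)].
Proof.
move=> L0 Lf Lg.
have /ClassicalEpsilon.choice [st hst] : forall z : nat * (R * R * R), exists z' : R * R * R,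
    0 < z.2.2 -> [/\ 0 < z'.2, z.2.1.1 <= z'.1.1 /\ z'.1.1 + z'.2 <= z.2.1.1 + z.2.2,
      z.2.1.2 <= z'.1.2 /\ z'.1.2 + z'.2 <= z.2.1.2 + z.2.2 &
      forall x, a z.1 <= x <= b z.1 -> ~ (z'.1.1 <= f z.1 x <= z'.1.1 + z'.2 /\
        z'.1.2 <= g z.1 x <= z'.1.2 + z'.2)].
  move=> [j [[u v] w]] /=; case: (Rlt_dec 0 w) => w0; last by exists (u, v, w).
  have [u' [v' [w' h]]] := square_minus_curve u v w0 (L0 j) (@Lf j) (@Lg j).
  by exists (u', v', w').
pose fix sq (j : nat) : R * R * R := if j is j'.+1 then st (j', sq j') else (0, 0, 1).
have sq0 j : 0 < (sq j).2.
  elim: j => [|j IH] /=; first lra.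
  by have [] := hst (j, sq j) IH.
have hsq j := hst (j, sq j) (sq0 j).
have nest i k : (sq i).1.1 <= (sq (i + k)%N).1.1 /\ (sq (i + k)%N).1.1 + (sq (i + k)%N).2 <= (sq i).1.1 + (sq i).2 /\
    (sq i).1.2 <= (sq (i + k)%N).1.2 /\ (sq (i + k)%N).1.2 + (sq (i + k)%N).2 <= (sq i).1.2 + (sq i).2.
  elim: k => [|k IH]; first by rewrite addn0; lra.
  by rewrite addnS /=; have [_ /= h1 h2 _] := hsq (i + k)%N; lra.
have cross i j : (sq i).1.1 <= (sq j).1.1 + (sq j).2 /\ (sq i).1.2 <= (sq j).1.2 + (sq j).2.
  have h1 := sq0 i; have h2 := sq0 j.
  case: (leqP i j) => ij.
    by have := nest i (j - i)%N; rewrite subnKC //; lra.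
  by have := nest j (i - j)%N; rewrite subnKC; [lra | exact: ltnW].
have lim (x w : nat -> R) : (forall i j, x i <= x j + w j) ->
    exists s, forall i, x i <= s <= x i + w i.
  move=> h; have [] := completeness (fun z => exists i, z = x i).
  - by exists (x 0%N + w 0%N) => z [i ->].
  - by exists (x 0%N), 0%N.
  move=> s [ub lub]; exists s => i; split; first by apply: ub; exists i.
  by apply: lub => z [j ->].
have [s hs] := lim (fun j => (sq j).1.1) (fun j => (sq j).2) (fun i j => (cross i j).1).
have [t ht] := lim (fun j => (sq j).1.2) (fun j => (sq j).2) (fun i j => (cross i j).2).
exists s, t; split.
- by have := hs 0%N; rewrite /=; lra.
- by have := ht 0%N; rewrite /=; lra.
move=> j x xab [fs gt]; have [_ _ _ /(_ x xab)] := hsq j; apply.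
by rewrite /= fs gt; split; [exact: (hs j.+1) | exact: (ht j.+1)].
Qed.

Definition C1_on (l0 l1 : R) (f f' : R -> R) := forall x, in_interval l0 l1 x ->
  derivable_pt_lim f x (f' x) /\ continuity_pt f' x.

Lemma C1_lipschitz (l0 l1 a b : R) (f f' : R -> R) : C1_on l0 l1 f f' -> l0 < a -> b < l1 ->
  exists2 Lam, 0 <= Lam & forall x y, a <= x <= b -> a <= y <= b ->
    Rabs (f x - f y) <= Lam * Rabs (x - y).
Proof.
move=> hf la bl; case: (Rle_dec a b) => ab; last by exists 0; [lra | move=> x y; lra].
have hI x : a <= x <= b -> in_interval l0 l1 x by rewrite /in_interval; lra.
have [|c [cM [c1 c2]]] := continuity_ab_maj (fun x => Rabs (f' x)) a b ab.
  move=> c /hI /hf [_ cc]; apply: (continuity_pt_comp f' Rabs) => //; exact: Rcontinuity_abs.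
have lt x y : a <= x <= b -> a <= y <= b -> x < y -> Rabs (f y - f x) <= Rabs (f' c) * Rabs (y - x).
  move=> xab yab xy; have [|d [-> hd]] := MVT_cor2 f f' x y xy.
    by move=> z hz; have [] : derivable_pt_lim f z (f' z) /\ continuity_pt f' z by apply/hf/hI; lra.
  rewrite Rabs_mult; apply: Rmult_le_compat_r; first exact: Rabs_pos.
  by apply: cM; lra.
exists (Rabs (f' c)); first exact: Rabs_pos.
move=> x y xab yab; case: (Rtotal_order x y) => [xy|[->|yx]].
- by rewrite Rabs_minus_sym (Rabs_minus_sym x); apply: lt.
- by rewrite !Rminus_diag Rabs_R0; lra.
- exact: lt.
Qed.

(** A C^1 function need not be Lipschitz up to the ends of the open interval, so each curve is cut
    into its restrictions to the compact intervals [[l0 + del j, l1 - del j]], which exhaust it. The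
    pairs (curve, [j]) remain countable. *)
Lemma avoid_C1_curves (T : countType) (l0 l1 : R) (f f' g g' : T -> R -> R) : l0 < l1 ->
  (forall k, C1_on l0 l1 (f k) (f' k)) -> (forall k, C1_on l0 l1 (g k) (g' k)) ->
  exists s t, [/\ 0 <= s <= 1, 0 <= t <= 1 &
    forall k x, in_interval l0 l1 x -> ~ (f k x = s /\ g k x = t)].
Proof.
move=> hl hf hg.
pose del (j : nat) := (l1 - l0) / (INR j + 2).
have del0 j : 0 < del j by apply: Rdiv_lt_0_compat; have := pos_INR j; lra.
pose a (z : T * nat) := l0 + del z.2; pose b (z : T * nat) := l1 - del z.2.
have /ClassicalEpsilon.choice [Lam hLam] : forall z : T * nat, exists Lam, [/\ 0 <= Lam,
    (forall x y, a z <= x <= b z -> a z <= y <= b z -> Rabs (f z.1 x - f z.1 y) <= Lam * Rabs (x - y)) &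
    (forall x y, a z <= x <= b z -> a z <= y <= b z -> Rabs (g z.1 x - g z.1 y) <= Lam * Rabs (x - y))].
  move=> z; have d0 := del0 z.2.
  have [||L1 p1 h1] := @C1_lipschitz l0 l1 (a z) (b z) _ _ (hf z.1); try (rewrite /a /b; lra).
  have [||L2 p2 h2] := @C1_lipschitz l0 l1 (a z) (b z) _ _ (hg z.1); try (rewrite /a /b; lra).
  exists (Rmax L1 L2); split; first by apply: Rle_trans p1 (Rmax_l _ _).
    move=> x y hx hy; apply: Rle_trans (h1 x y hx hy) _.
    by apply: Rmult_le_compat_r; [exact: Rabs_pos | exact: Rmax_l].
  move=> x y hx hy; apply: Rle_trans (h2 x y hx hy) _.
  by apply: Rmult_le_compat_r; [exact: Rabs_pos | exact: Rmax_r].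
(* Integers that encode no pair receive the constant curve 0 over the single point 0, with Lipschitz
   constant 0. *)
pose dec (A : Type) (d : A) (h : T * nat -> A) (j : nat) : A :=
  if @unpickle (T * nat)%type j is Some z then h z else d.
have [|||s [t [hs ht av]]] := @avoid_curves (dec (R -> R) (fun=> 0) (fun z => f z.1))
    (dec (R -> R) (fun=> 0) (fun z => g z.1)) (dec R 0 a) (dec R 0 b) (dec R 0 Lam).
- by move=> j; rewrite /dec; case: unpickle => [z|]; [case: (hLam z) | lra].
- move=> j x y; rewrite /dec; case: unpickle => [z|]; first by case: (hLam z) => _ h _; apply: h.
  by rewrite Rminus_diag Rabs_R0; lra.
- move=> j x y; rewrite /dec; case: unpickle => [z|]; first by case: (hLam z) => _ _ h; apply: h.
  by rewrite Rminus_diag Rabs_R0; lra.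
exists s, t; split => // k x [x0 x1].
pose mu := Rmin (x - l0) (l1 - x); have mu0 : 0 < mu by apply: Rmin_pos; lra.
have [j hj] := INR_unbounded ((l1 - l0) / mu).
have dj : del j <= mu.
  have j2 : 0 < INR j + 2 by have := pos_INR j; lra.
  apply: (Rmult_le_reg_r (INR j + 2)) => //; rewrite /del.
  have -> : (l1 - l0) / (INR j + 2) * (INR j + 2) = (l1 - l0) / mu * mu by field; lra.
  by rewrite Rmult_comm; apply: Rmult_le_compat_l; lra.
have m1 := Rmin_l (x - l0) (l1 - x); have m2 := Rmin_r (x - l0) (l1 - x).
have := av (pickle (k, j)) x; rewrite /dec pickleK /=; apply.
by rewrite /a /b /= -/mu in m1 m2 *; lra.
Qed.
End Avoidance.

(** * Openness and density *)

Section C1Functions.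
Local Open Scope R_scope.
Variables (l0 l1 : R).

Definition is_C1 f := exists f', C1_on l0 l1 f f'.

Lemma is_C1_continuity f x : is_C1 f -> in_interval l0 l1 x -> continuity_pt f x.
Proof.
move=> [f' hf] /hf [d _]; apply: derivable_continuous_pt; by exists (f' x).
Qed.

Lemma is_C1_const c : is_C1 (fun=> c).
Proof.
exists (fun=> 0) => x _; split; first exact: derivable_pt_lim_const.
by apply: continuity_pt_const.
Qed.

Lemma is_C1_add f g : is_C1 f -> is_C1 g -> is_C1 (fun x => f x + g x).
Proof.
move=> [f' hf] [g' hg]; exists (fun x => f' x + g' x) => x Ix.
have [df cf] := hf x Ix; have [dg cg] := hg x Ix.
by split; [exact: derivable_pt_lim_plus | exact: continuity_pt_plus].
Qed.

Lemma is_C1_scal c f : is_C1 f -> is_C1 (fun x => c * f x).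
Proof.
move=> [f' hf]; exists (fun x => c * f' x) => x Ix; have [df cf] := hf x Ix.
by split; [exact: derivable_pt_lim_scal | exact: continuity_pt_scal].
Qed.

Lemma is_C1_div f g : is_C1 f -> is_C1 g -> (forall x, in_interval l0 l1 x -> g x <> 0) ->
  is_C1 (fun x => f x / g x).
Proof.
move=> Cf Cg g0; have [f' hf] := Cf; have [g' hg] := Cg.
exists (fun x => (f' x * g x - g' x * f x) / Rsqr (g x)) => x Ix.
have [df cf] := hf x Ix; have [dg cg] := hg x Ix.
have kf := is_C1_continuity Cf Ix; have kg := is_C1_continuity Cg Ix.
split; first exact: (derivable_pt_lim_div f g x _ _ df dg (g0 x Ix)).
apply: continuity_pt_div; last by apply: Rmult_integral_contrapositive; split; apply: g0.
  by apply: continuity_pt_minus; apply: continuity_pt_mult.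
exact: (continuity_pt_mult g g).
Qed.
End C1Functions.

Section Linforms.
Local Open Scope R_scope.

Lemma sum_fun_closed (A : Type) (Q : (A -> R) -> Prop) : Q (fun=> 0) ->
  (forall f g, Q f -> Q g -> Q (fun x => f x + g x)) ->
  forall (I : Type) (r : seq I) (F : I -> A -> R), (forall i, Q (F i)) ->
    Q (fun x => \sum_(i <- r) F i x)%R.
Proof.
move=> Q0 QD I r F QF; elim: r => [|i r IH].
  have -> // : (fun x => \sum_(i <- [::]) F i x)%R = (fun=> 0).
  by apply: functional_extensionality => x; rewrite big_nil.
have -> : (fun x => \sum_(j <- i :: r) F j x)%R = (fun x => F i x + (\sum_(j <- r) F j x)%R).
  by apply: functional_extensionality => x; rewrite big_cons.
exact: QD.
Qed.

Lemma linform0 n (phi : 'M[R]_n -> R) : linform phi -> phi 0%R = 0%R.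
Proof.
move=> lin; have := lin 1%R 0%R 0%R; rewrite scaler0 addr0 mul1r.
by move/eqP; rewrite -subr_eq0 opprD addrA subrr sub0r oppr_eq0 => /eqP.
Qed.

Lemma linform_coords n (phi : 'M[R]_n -> R) : linform phi ->
  forall X, phi X = (\sum_i \sum_j phi (delta_mx i j) * X i j)%R.
Proof.
move=> lin; have phi0 := linform0 lin.
have phiD X Y : phi (X + Y)%R = (phi X + phi Y)%R by have := lin 1%R X Y; rewrite scale1r mul1r.
have phiZ c X : phi (c *: X)%R = (c * phi X)%R by have := lin c X 0%R; rewrite phi0 !addr0.
move=> X; rewrite {1}(matrix_sum_delta X) (big_morph phi phiD phi0).
apply: eq_bigr => i _; rewrite (big_morph phi phiD phi0); apply: eq_bigr => j _.
by rewrite phiZ mulrC.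
Qed.

Lemma linform_bound n (phi : 'M[R]_n -> R) : linform phi ->
  exists2 C, 0 <= C & forall (X : 'M[R]_n) e, 0 <= e -> (forall i j, Rabs (X i j) <= e) -> Rabs (phi X) <= C * e.
Proof.
move=> lin.
pose Q (f : 'M[R]_n -> R) := exists2 C, 0 <= C & forall (X : 'M[R]_n) e, 0 <= e ->
  (forall i j, Rabs (X i j) <= e) -> Rabs (f X) <= C * e.
change (Q phi).
have -> : phi = (fun X : 'M[R]_n => \sum_i \sum_j phi (delta_mx i j) * X i j)%R.
  by apply: functional_extensionality; apply: linform_coords.
have Q0 : Q (fun=> 0) by exists 0; [lra | move=> X e _ _; rewrite Rabs_R0; lra].
have QD f g : Q f -> Q g -> Q (fun x => f x + g x).
  move=> [C C0 hC] [D D0 hD]; exists (C + D); first lra.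
  move=> X e e0 h; apply: Rle_trans (Rabs_triang _ _) _.
  by have := hC X e e0 h; have := hD X e e0 h; lra.
apply: (sum_fun_closed Q0 QD) => i; apply: (sum_fun_closed Q0 QD) => j.
exists (Rabs (phi (delta_mx i j))); first exact: Rabs_pos.
move=> X e e0 h; change (Rabs (phi (delta_mx i j) * X i j) <= Rabs (phi (delta_mx i j)) * e).
by rewrite Rabs_mult; apply: Rmult_le_compat_l; [exact: Rabs_pos | exact: h].
Qed.

Lemma linform_C1 n l0 l1 (phi : 'M[R]_n -> R) (L L' : R -> 'M[R]_n) : linform phi ->
  C1_curve l0 l1 L L' -> is_C1 l0 l1 (fun x => phi (L x)).
Proof.
move=> lin hL.
have -> : (fun x => phi (L x)) = (fun x => \sum_i \sum_j phi (delta_mx i j) * L x i j)%R.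
  by apply: functional_extensionality => x; apply: linform_coords.
have Q0 := is_C1_const l0 l1 0; have QD := @is_C1_add l0 l1.
apply: (sum_fun_closed Q0 QD) => i; apply: (sum_fun_closed Q0 QD) => j.
apply: (is_C1_scal (phi (delta_mx i j)) (f := fun x => L x i j)).
by exists (fun x => L' x i j) => x Ix; apply: hL.
Qed.

Lemma finite_radius (T : finType) (P : T -> R -> Prop) :
  (forall k, exists2 d, 0 < d & forall d', 0 < d' <= d -> P k d') ->
  exists2 d, 0 < d & forall k, P k d.
Proof.
move=> h; suff [d d0 hd] : exists2 d, 0 < d & forall k, k \in enum T -> forall d', 0 < d' <= d -> P k d'.
  by exists d => // k; apply: hd; [rewrite mem_enum | lra].
elim: (enum T) => [|k s [d d0 hd]]; first by exists 1; [lra | move=> k].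
have [e e0 he] := h k; exists (Rmin d e); first exact: Rmin_pos.
have m1 := Rmin_l d e; have m2 := Rmin_r d e.
move=> k'; rewrite inE => /orP [/eqP ->|k's] d' hd'; first by apply: he; lra.
by apply: hd => //; lra.
Qed.
End Linforms.

(** * Openness: balls of good endomorphisms *)

Section Openness.
Local Open Scope R_scope.
Variables (S : Type) (n : nat) (rho : S -> 'M[R]_n) (m : nat) (p : 'I_m -> 'M[R]_n).
Hypotheses (prim_p : forall i, prim_idem rho (p i)) (sum_p : (\sum_i p i = 1)%R).
Hypothesis nonequiv_p : forall i j, equiv_idem rho (p i) (p j) -> i = j.

Definition good_ball (X : 'M[R]_n) (d : R) := forall Y, is_endo rho Y ->
  (forall i j, Rabs (Y i j - X i j) <= d) -> good rho Y.

Lemma good_open X : is_endo rho X -> good rho X -> exists2 d, 0 < d & good_ball X d.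
Proof.
move=> hX gX.
have [phi [lin hphi]] := good_open_forms prim_p sum_p nonequiv_p hX gX.
have [|d d0 hd] := @finite_radius 'I_m (fun i d => forall Y : 'M[R]_n,
    (forall i j, Rabs (Y i j - X i j) <= d) -> phi i X != 0%R -> phi i Y != 0%R).
  move=> i; have [C C0 hC] := linform_bound (lin i).
  case: (Req_dec (phi i X) 0) => [z|nz].
    by exists 1; [lra | move=> d' _ Y _; rewrite z eqxx].
  have a0 : 0 < Rabs (phi i X) by apply: Rabs_pos_lt.
  have b0 : 0 < / (C + 1) by apply: Rinv_0_lt_compat; lra.
  (* At this radius [phi i] varies by at most [C / (C + 1)] of its modulus at [X], so it cannot
     reach 0; adding 1 also covers [C = 0]. *)
  exists (Rabs (phi i X) * / (C + 1)); first exact: Rmult_lt_0_compat.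
  move=> d [d0 hd] Y YX _; apply/eqP => Y0.
  have hYX : forall i0 j : 'I_n, Rabs ((Y - X)%R i0 j) <= d by move=> i0 j; rewrite !mxE; apply: YX.
  have := hC (Y - X)%R d (Rlt_le _ _ d0) hYX.
  have -> : phi i (Y - X)%R = - phi i X.
    have := lin i (-1)%R X Y; rewrite Y0 addr0 mulN1r scaleN1r addrC => ->.
    by [].
  rewrite Rabs_Ropp => h.
  have : C * d <= C * (Rabs (phi i X) * / (C + 1)) by apply: Rmult_le_compat_l.
  have e1 : (C + 1) * / (C + 1) = 1 by apply: Rinv_r; lra.
  have e2 : Rabs (phi i X) = Rabs (phi i X) * ((C + 1) * / (C + 1)) by rewrite e1; lra.
  nra.
exists d => // Y hY YX; apply: hphi => // i; exact: hd.
Qed.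

(** The supremum [r x] of the radii, at most 1, of good balls around [L x] is 1-Lipschitz in [L x]:
    a good ball of radius [d] contains one of radius [d - e] around any point at distance [e]. Hence
    it is continuous along the curve, which an arbitrary choice of radii would not ensure. *)
Lemma general_position_open (l0 l1 : R) (L L' : R -> 'M[R]_n) :
  C1_End_curve rho l0 l1 L L' -> general_position rho l0 l1 L ->
  exists eps : R -> R, pos_cont_fun l0 l1 eps /\
    forall M M' : R -> 'M[R]_n,
      C1_End_curve rho l0 l1 M M' -> C1_close l0 l1 eps L L' M M' ->
      general_position rho l0 l1 M.
Proof.
move=> [cL eL] gL; pose E x d := d <= 1 /\ good_ball (L x) d.
have /ClassicalEpsilon.choice [r hr] : forall x, exists r, in_interval l0 l1 x -> 0 < r /\ is_lub (E x) r.
  move=> x; case: (classic (in_interval l0 l1 x)) => Ix; last by exists 0.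
  have [d d0 gd] := good_open (eL x Ix) (gL x Ix).
  have Ed : E x (Rmin 1 d).
    split; first exact: Rmin_l.
    by move=> Y hY YX; apply: gd => // i j; apply: Rle_trans (YX i j) (Rmin_r _ _).
  have [||r lub] := completeness (E x); first by exists 1 => z [].
    by exists (Rmin 1 d).
  exists r => _; split => //; have [ub _] := lub.
  by have := ub _ Ed; have : 0 < Rmin 1 d by [apply: Rmin_pos; lra]; lra.
have lip x y e : in_interval l0 l1 x -> in_interval l0 l1 y -> 0 <= e ->
    (forall i j, Rabs (L y i j - L x i j) <= e) -> r x <= r y + e.
  move=> Ix Iy e0 xy; have [_ [_ lub]] := hr x Ix; have [_ [ub _]] := hr y Iy.
  apply: lub => d [d1 gd]; suff : d - e <= r y by lra.
  apply: ub; split; first lra.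
  move=> Y hY YX; apply: gd => // i j.
  have := Rabs_triang (Y i j - L y i j) (L y i j - L x i j).
  have -> : Y i j - L y i j + (L y i j - L x i j) = Y i j - L x i j by ring.
  by have := YX i j; have := xy i j; lra.
(* Half the supremum lies strictly below some good radius, whether or not the supremum is
   attained. *)
exists (fun x => r x / 2); split.
  move=> x Ix; have [r0 _] := hr x Ix; split; first lra.
  move=> eta eta0.
  have [|d d0 hd] := @finite_radius ('I_n * 'I_n)%type (fun k d => forall y,
      Rabs (y - x) < d -> Rabs (L y k.1 k.2 - L x k.1 k.2) <= eta).
    move=> [i j] /=; have [dL _] := cL x Ix i j.
    have cLx : continuity_pt (fun t => L t i j) x.
      by apply: derivable_continuous_pt; exists (L' x i j).
    have [al [al0 hal]] := cLx eta eta0; exists al => //.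
    move=> d [d0 dal] y yx; case: (Req_dec x y) => [->|xy]; first by rewrite Rminus_diag Rabs_R0; lra.
    apply/Rlt_le/(hal y); split; first by split.
    by rewrite /= /Rdist; lra.
  pose d1 := Rmin d (Rmin (x - l0) (l1 - x)).
  have [x0 x1] := Ix.
  have d10 : 0 < d1 by apply: Rmin_pos => //; apply: Rmin_pos; lra.
  exists d1; split => // y [_]; rewrite /= /Rdist => yx.
  have a1 := Rmin_l d (Rmin (x - l0) (l1 - x)); have a2 := Rmin_r d (Rmin (x - l0) (l1 - x)).
  have a3 := Rmin_l (x - l0) (l1 - x); have a4 := Rmin_r (x - l0) (l1 - x).
  have [b1 b2] : - d1 <= y - x <= d1 by apply: Rabs_le_bounds; lra.
  have yx' : Rabs (y - x) < Rmin (x - l0) (l1 - x) by apply: Rlt_le_trans yx a2.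
  have Iy : in_interval l0 l1 y by rewrite /in_interval; move: yx'; rewrite /Rabs; case: Rcase_abs; lra.
  have close i j : Rabs (L y i j - L x i j) <= eta by apply: (hd (i, j)); apply: Rlt_le_trans yx a1.
  have h1 : r x <= r y + eta by apply: lip => //; lra.
  have h2 : r y <= r x + eta.
    by apply: lip => //; [lra | move=> i j; rewrite Rabs_minus_sym].
  by rewrite /Rabs; case: Rcase_abs; lra.
move=> M M' [_ eM] close x Ix; have [r0 [_ lub]] := hr x Ix.
have [d [Ed dr]] : exists d, E x d /\ r x / 2 < d.
  apply: NNPP => h; suff : r x <= r x / 2 by lra.
  by apply: lub => d Ed; apply: Rnot_lt_le => rd; apply: h; exists d.
have [_ gd] := Ed; apply: gd; first exact: eM.
by move=> i j; have [h _] := close x Ix i j; lra.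
Qed.
End Openness.

(** * Density by a two-parameter perturbation *)

Section Density.
Local Open Scope R_scope.
Variables (S : Type) (n : nat) (rho : S -> 'M[R]_n) (m : nat) (p : 'I_m -> 'M[R]_n).
Hypotheses (prim_p : forall i, prim_idem rho (p i)) (sum_p : (\sum_i p i = 1)%R).
Hypothesis nonequiv_p : forall i j, equiv_idem rho (p i) (p j) -> i = j.
Hypothesis orth_p : forall i j, i != j -> (p i * p j = 0)%R.

(** Taking reciprocals turns upper bounds into radii, so that [finite_radius] applies to the
    entries. *)
Lemma matrix_bound (X : 'M[R]_n) : exists2 B, 0 < B & forall i j, Rabs (X i j) <= B.
Proof.
have [|d d0 hd] := @finite_radius ('I_n * 'I_n)%type (fun k d => Rabs (X k.1 k.2) <= / d).
  move=> k; have a0 := Rabs_pos (X k.1 k.2).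
  exists (/ (Rabs (X k.1 k.2) + 1)); first by apply: Rinv_0_lt_compat; lra.
  move=> d [d0 hd]; apply: (Rle_trans _ (Rabs (X k.1 k.2) + 1)); first lra.
  rewrite -(Rinv_inv (Rabs (X k.1 k.2) + 1)); exact: Rinv_le_contravar.
by exists (/ d); [exact: Rinv_0_lt_compat | move=> i j; apply: (hd (i, j))].
Qed.

Lemma linform_sum (phi : 'M[R]_n -> R) (T : finType) (P : pred T) (c : T -> R) (F : T -> 'M[R]_n) :
  linform phi -> phi (\sum_(k | P k) c k *: F k)%R = (\sum_(k | P k) c k * phi (F k))%R.
Proof.
move=> lin; have phi0 := linform0 lin.
elim/big_rec2: _ => [|k y X _ <-]; first exact: phi0.
exact: lin.
Qed.

(** A bad value at [x] makes two forms vanish, that is [s + t * c k = h k x] and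
    [s + t * c l = h l x]. Solving gives [s = hs (k, l) x] and [t = ht (k, l) x], C^1 functions of
    [x] that do not involve the chosen pair: it suffices to take [(s, t)] off all these curves. *)
Lemma general_position_dense (l0 l1 : R) (L L' : R -> 'M[R]_n) (eps : R -> R) : l0 < l1 ->
  C1_End_curve rho l0 l1 L L' -> pos_cont_fun l0 l1 eps ->
  exists M M' : R -> 'M[R]_n,
    [/\ C1_End_curve rho l0 l1 M M', C1_close l0 l1 eps L L' M M'
      & general_position rho l0 l1 M].
Proof.
move=> hl [cL eL] heps.
have [valid [phi [P [lin eP dual bad]]]] := bad_forms prim_p sum_p nonequiv_p orth_p.
(* The coefficient of [P k] in the perturbation is [s + t c_k]: as the [c_k] are distinct,
   the vanishing of two of the forms [phi k] determines [(s, t)]. *)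
pose c (k : 'I_m * bool) := INR (enum_rank k).
have c_inj k l : c k = c l -> k = l by move=> /INR_eq /ord_inj /enum_rank_inj.
pose P1 := (\sum_(k | valid k) 1%R *: P k)%R; pose P2 := (\sum_(k | valid k) c k *: P k)%R.
have phiP (a : 'I_m * bool -> R) k : valid k -> phi k (\sum_(l | valid l) a l *: P l)%R = a k.
  move=> vk; rewrite linform_sum // (bigD1 k) //= dual // eqxx mulr1 big1 ?addr0 // => l /andP [vl lk].
  by rewrite dual // eq_sym (negbTE lk) mulr0.
have [B1 B10 hB1] := matrix_bound P1; have [B2 B20 hB2] := matrix_bound P2.
(* Since [s] and [t] lie between 0 and 1, the entries of the perturbing matrix are at most
   [B1 + B2 < B]; [psi] is therefore taken below [eps / B]. *)
pose B := B1 + B2 + 1; have B0 : 0 < / B by apply: Rinv_0_lt_compat; rewrite /B; lra.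
have BB : / B * B = 1 by apply: Rinv_l; rewrite /B; lra.
have [|psi [psi' hpsi]] := @small_C1_function l0 l1 (fun x => / B * eps x) hl.
  move=> x Ix; have [e0 ce] := heps x Ix; split; first exact: Rmult_lt_0_compat.
  exact: (continuity_pt_scal eps (/ B)).
have Cpsi : is_C1 l0 l1 psi by exists psi' => x /hpsi [].
have psi0 x : in_interval l0 l1 x -> psi x <> 0 by move=> /hpsi [] [] h; lra.
pose h k x := -1 * phi k (L x) / psi x.
have Ch k : is_C1 l0 l1 (h k).
  by apply: is_C1_div => //; apply: is_C1_scal; apply: linform_C1 cL.
(* When both indices agree the factor is the inverse of 0, still a constant, so the C^1 family can
   be indexed by all pairs. *)
pose ht (z : ('I_m * bool) * ('I_m * bool)) x := / (c z.1 - c z.2) * (h z.1 x + -1 * h z.2 x).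
pose hs z x := h z.1 x + (- c z.1) * ht z x.
have Cht z : is_C1 l0 l1 (ht z).
  by apply: is_C1_scal; apply: is_C1_add => //; apply: is_C1_scal.
have Chs z : is_C1 l0 l1 (hs z) by apply: is_C1_add => //; apply: is_C1_scal.
have /ClassicalEpsilon.choice [ht' dht] := Cht; have /ClassicalEpsilon.choice [hs' dhs] := Chs.
have [s [t [s01 t01 av]]] := avoid_C1_curves hl dhs dht.
pose V := (s *: P1 + t *: P2)%R.
have eV : is_endo rho V.
  by apply: endoD; apply: endoZ; apply: endo_sum => k _; apply: endoZ.
have hV i j : Rabs (V i j) <= B1 + B2.
  have -> : V i j = s * P1 i j + t * P2 i j by rewrite !mxE.
  have h1 := hB1 i j; have h2 := hB2 i j.
  have a1 := Rabs_pos (P1 i j); have a2 := Rabs_pos (P2 i j).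
  apply: Rle_trans (Rabs_triang _ _) _; rewrite !Rabs_mult (Rabs_pos_eq s) ?(Rabs_pos_eq t); try lra.
  move: (Rabs (P1 i j)) (Rabs (P2 i j)) h1 h2 a1 a2 => b1 b2 h1 h2 a1 a2.
  have : s * b1 <= 1 * B1 by apply: Rmult_le_compat; lra.
  have : t * b2 <= 1 * B2 by apply: Rmult_le_compat; lra.
  lra.
have VE : V = (\sum_(k | valid k) (s + t * c k)%R *: P k)%R.
  rewrite /V /P1 /P2 !scaler_sumr -big_split /=; apply: eq_bigr => k _.
  by rewrite !scalerA -scalerDl mulr1.
pose M x := (L x + psi x *: V)%R; pose M' x := (L' x + psi' x *: V)%R.
have ME x i j : M x i j = L x i j + psi x * V i j by rewrite !mxE.
have M'E x i j : M' x i j = L' x i j + psi' x * V i j by rewrite !mxE.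
have eM x : in_interval l0 l1 x -> is_endo rho (M x).
  by move=> Ix; apply: endoD; [exact: eL | exact: endoZ].
exists M, M'; split.
- split=> // x Ix i j; have [dL cL'] := cL x Ix i j; have [_ dp _ cp] := hpsi x Ix.
  have -> : (fun y => M y i j) = (fun y => L y i j + psi y * V i j).
    by apply: functional_extensionality => y; apply: ME.
  have -> : (fun y => M' y i j) = (fun y => L' y i j + psi' y * V i j).
    by apply: functional_extensionality => y; apply: M'E.
  rewrite M'E; split.
    apply: (derivable_pt_lim_plus (fun y => L y i j) (fun y => psi y * V i j)) => //.
    have -> : psi' x * V i j = psi' x * V i j + psi x * 0 by ring.
    by apply: (derivable_pt_lim_mult psi (fun=> V i j)) => //; apply: derivable_pt_lim_const.
  apply: (continuity_pt_plus (fun y => L' y i j) (fun y => psi' y * V i j)) => //.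
  by apply: (continuity_pt_mult psi' (fun=> V i j)) => //; apply: continuity_pt_const.
- move=> x Ix i j; have [[p0 p1] _ p' _] := hpsi x Ix; have [e0 _] := heps x Ix.
  have small q : Rabs q < / B * eps x -> Rabs (q * V i j) < eps x.
    move=> hq; rewrite Rabs_mult; have hv := hV i j; have v0 := Rabs_pos (V i j).
    have q0 := Rabs_pos q.
    apply: (Rle_lt_trans _ (/ B * eps x * (B1 + B2))); first by apply: Rmult_le_compat; lra.
    have -> : / B * eps x * (B1 + B2) = eps x * (/ B * B) - / B * eps x by rewrite /B; ring.
    have : 0 < / B * eps x by apply: Rmult_lt_0_compat.
    by rewrite BB; lra.
  rewrite ME M'E; split.
    have -> : L x i j + psi x * V i j - L x i j = psi x * V i j by ring.
    by apply: small; rewrite Rabs_pos_eq; lra.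
  have -> : L' x i j + psi' x * V i j - L' x i j = psi' x * V i j by ring.
  exact: small.
- move=> x Ix; apply: NNPP => nb.
  have [k [l [vk vl kl fk fl]]] := bad _ (eM x Ix) nb.
  have ckl : c k - c l <> 0 by move=> z; move/eqP: kl; apply; apply: c_inj; lra.
  have p0 := psi0 x Ix.
  have root q : valid q -> phi q (M x) = 0 -> s + t * c q = h q x.
    move=> vq; have -> : phi q (M x) = psi x * (s + t * c q) + phi q (L x).
      by rewrite /M addrC lin VE phiP.
    move=> z; apply: (Rmult_eq_reg_l (psi x)) => //.
    have -> : psi x * h q x = - phi q (L x) by rewrite /h; field.
    lra.
  have rk := root k vk fk; have rl := root l vl fl.
  have tE : ht (k, l) x = t by rewrite /ht /= -rk -rl; field.
  by apply: (av (k, l) x Ix); split => //; rewrite /hs tE /= -rk; ring.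
Qed.
End Density.

Theorem mainTheorem14
  (S : Type) (mul : S -> S -> S) (mulA : associative mul)
  (n : nat) (rho : S -> 'M[R]_n)
  (hrep : is_representation mul rho)
  (hsplit : splits_nonisomorphic_indecomposables rho)
  (l0 l1 : R) (hl : Rlt l0 l1) :
  (* open in the C^1 (Whitney) topology *)
  (forall L L' : R -> 'M[R]_n,
     C1_End_curve rho l0 l1 L L' -> general_position rho l0 l1 L ->
     exists eps : R -> R, pos_cont_fun l0 l1 eps /\
       forall M M' : R -> 'M[R]_n,
         C1_End_curve rho l0 l1 M M' -> C1_close l0 l1 eps L L' M M' ->
         general_position rho l0 l1 M)
  /\
  (* dense in the C^1 (Whitney) topology *)
  (forall (L L' : R -> 'M[R]_n) (eps : R -> R),
     C1_End_curve rho l0 l1 L L' -> pos_cont_fun l0 l1 eps ->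
     exists M M' : R -> 'M[R]_n,
       [/\ C1_End_curve rho l0 l1 M M', C1_close l0 l1 eps L L' M M'
         & general_position rho l0 l1 M]).
Proof.
have [m [p [prim_p sum_p nonequiv_p orth_p]]] := splitting_idempotents hsplit.
split=> [L L'|L L' eps]; first exact: (general_position_open prim_p).
exact: (general_position_dense prim_p).
Qed.
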